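(* For $d>2$ and $\alpha=(\alpha_1,\ldots,\alpha_d)\in\mathbb{N}_0^d$, define, in the spherical polar coordinates given in the context, $$Y_\alpha(x):=[h_\alpha]^{-1}\, r^{|\alpha|}\,g_\alpha(\theta_1)\prod_{j=1}^{d-2}(\sin\theta_{d-j})^{|\alpha^{j+1}|}\,C_{\alpha_j}^{\lambda_j}(\cos\theta_{d-j}),$$ where $g_\alpha(\theta_1)=\cos(\alpha_{d-1}\theta_1)$ for $\alpha_d=0$ and $g_\alpha(\theta_1)=\sin(\alpha_{d-1}\theta_1)$ for $\alpha_d=1$; $|\alpha^j|=\alpha_j+\cdots+\alpha_{d-1}$; $\lambda_j=|\alpha^{j+1}|+\frac{d-j-1}{2}$; and $$[h_\alpha]^2:=b_\alpha\prod_{j=1}^{d-2}\frac{\alpha_j!\,\left(\frac{d-j+1}{2}\right)_{|\alpha^{j+1}|}(\alpha_j+\lambda_j)}{(2\lambda_j)_{\alpha_j}\left(\frac{d-j}{2}\right)_{|\alpha^{j+1}|}\lambda_j},$$ in which $b_\alpha=2$ if $\alpha_{d-1}+\alpha_d>0$, while $b_\alpha=1$ otherwise. Then $\{Y_\alpha:|\alpha|=n,\ \alpha_d=0,1\}$ is an orthonormal basis of $\mathcal{H}_n^d$; that is, $\langle Y_\alpha,Y_\beta\rangle_{\mathbb{S}^{d-1}}=\delta_{\alpha,\beta}$.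
   Context: $\mathbb{N}_0$ is the set of nonnegative integers, $n\in\mathbb{N}_0$, and $|\alpha|=\alpha_1+\cdots+\alpha_d$. Spherical polar coordinates on $\mathbb{R}^d$: $x_1=r\sin\theta_{d-1}\cdots\sin\theta_2\sin\theta_1$, $x_2=r\sin\theta_{d-1}\cdots\sin\theta_2\cos\theta_1$, $x_k=r\sin\theta_{d-1}\cdots\sin\theta_{k}\cos\theta_{k-1}$ for $3\le k\le d-1$, and $x_d=r\cos\theta_{d-1}$, with $r\ge0$, $0\le\theta_1\le2\pi$ and $0\le\theta_i\le\pi$ for $2\le i\le d-1$. $\mathcal{H}_n^d$ is the real vector space of real harmonic polynomials on $\mathbb{R}^d$ that are homogeneous of degree $n$. The inner product is $\langle f,g\rangle_{\mathbb{S}^{d-1}}=\frac1{\omega_d}\int_{\mathbb{S}^{d-1}}f(x)g(x)\,d\sigma(x)$, where $d\sigma$ is the surface area measure on the unit sphere $\mathbb{S}^{d-1}$ of $\mathbb{R}^d$ and $\omega_d=\int_{\mathbb{S}^{d-1}}d\sigma=2\pi^{d/2}/\Gamma(d/2)$. $\delta_{\alpha,\beta}$ is $1$ if $\alpha=\beta$ and $0$ otherwise. $(a)_k=a(a+1)\cdots(a+k-1)$, with $(a)_0=1$, is the Pochhammer symbol. For $\lambda>0$ and $m\in\mathbb{N}_0$, $C_m^\lambda$ is the Gegenbauer polynomial $C_m^\lambda(t)=\frac{(\lambda)_m2^m}{m!}\sum_{0\le j\le m/2}\frac{(-\frac m2)_j(\frac{1-m}{2})_j}{j!\,(1-m-\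lambda)_j}t^{m-2j}$.
   Formalization: The factor is h_α, not [h_α]^{-1}; for α_d=1, g_α(θ_1)=sin((α_{d-1}+1)θ_1); and |α^j|=α_j+…+α_d. As printed the claim fails: for d=3, α=(1,0,0) gives squared norm 1/9 and α=(0,0,1) gives Y_α=0. *)

(* Defs.v *)
From HB Require Import structures.
From mathcomp Require Import all_boot all_order all_algebra.
From mathcomp Require Import all_classical all_reals all_analysis.
From mathcomp Require mpoly.

Set Implicit Arguments.
Unset Strict Implicit.
Unset Printing Implicit Defensive.

Import Order.TTheory GRing.Theory Num.Theory.
Import numFieldNormedType.Exports.
Import -(notations) mpoly.

Local Open Scope classical_set_scope.
Local Open Scope ring_scope.

Section Basis.
Context {R : realType} {V : lmodType R} {I : choiceType}.

(* [\sum_(i \in A)] sums over the support of the summand in [A], and is [0]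
   when that support is infinite; finiteness of [A] makes it the plain sum. *)
Definition is_basis (A : set I) (Y : I -> V) (H : set V) : Prop :=
  [/\ finite_set A,
      forall i, A i -> H (Y i),
      forall c : I -> R,
        \sum_(i \in A) c i *: Y i = 0 -> forall i, A i -> c i = 0
    & forall v, H v -> exists c : I -> R, v = \sum_(i \in A) c i *: Y i].

End Basis.

Section Polynomials.
Context {R : realType}.

Definition laplacian d (p : mpoly d R) : mpoly d R :=
  \sum_(i < d) mderiv i (mderiv i p).

(* Homogeneous harmonic polynomials of degree n, as functions on R^d. *)
Definition harmonic_space (d n : nat) : set ('rV[R]_d -> R) :=
  [set f | exists p : mpoly d R,
     [/\ p \is ishomog1 n mdeg,
         laplacian p = 0
       & forall x : 'rV[R]_d, f x = meval (fun i => x 0 i) p]].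

Definition pochhammer (a : R) (k : nat) : R := \prod_(i < k) (a + i%:R).

Definition gegenbauer (lam : R) (m : nat) (t : R) : R :=
  pochhammer lam m * 2 ^+ m / m`!%:R *
  \sum_(j < (m./2).+1)
     pochhammer (- (m%:R / 2)) j * pochhammer ((1 - m%:R) / 2) j /
     (j`!%:R * pochhammer (1 - m%:R - lam) j) * t ^+ (m - j.*2).

End Polynomials.

Arguments harmonic_space : clear implicits.

Section SurfaceIntegral.
Context {R : realType}.

(* Lebesgue integral of F over the box D 0 x ... x D (m - 1), as an iterated
   integral. *)
Fixpoint box_integral (m : nat) (D : nat -> set R) : ('rV[R]_m -> R) -> R :=
  match m return ('rV[R]_m -> R) -> R with
  | 0 => fun F => F 0
  | m'.+1 => fun F =>
      (\int[lebesgue_measure]_(t in D 0)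
         @box_integral m' (fun i => D i.+1)
           (fun v : 'rV[R]_m' => F (row_mx (t%:M : 'rV[R]_1) v)))%R
  end.

(* Integral of f against the area measure of the surface parametrized by phi
   over a box. As [jacobian phi u] acts on row vectors, J J^T is the Gram matrix
   of the partial derivatives of phi. *)
Definition surface_integral (m k : nat) (D : nat -> set R)
    (phi : 'rV[R]_m -> 'rV[R]_k) (f : 'rV[R]_k -> R) : R :=
  box_integral D (fun u : 'rV[R]_m =>
    f (phi u) * Num.sqrt (\det (jacobian phi u *m (jacobian phi u)^T))).

End SurfaceIntegral.

Section Polar.
Context {R : realType} (d : nat).

(* theta_j, for 1 <= j <= d - 1. *)
Definition angle (theta : 'rV[R]_d.-1) (j : nat) : R :=
  odflt 0 (omap (theta 0) (insub j.-1)).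

(* With k = i + 1, x_k = r cos theta_(k-1) sin theta_k ... sin theta_(d-1),
   without the cosine for k = 1. *)
Definition polar (r : R) (theta : 'rV[R]_d.-1) : 'rV[R]_d :=
  \row_(i < d)
    (r * (if i == 0%N :> nat then 1 else cos (angle theta i)) *
     \prod_(i.+1 <= j < d) sin (angle theta j)).

(* Ranges of theta_1, theta_2, ..., numbered from 0. *)
Definition angle_range (i : nat) : set R :=
  if i == 0%N then `[0, 2 * pi]%classic else `[0, pi]%classic.

Definition polar_coordinates (x : 'rV[R]_d) : set (R * 'rV[R]_d.-1) :=
  [set p : R * 'rV[R]_d.-1 |
     [/\ 0 <= p.1,
         forall i : 'I_d.-1, angle_range i (p.2 0 i)
       & polar p.1 p.2 = x]].

Definition sphere_integral (f : 'rV[R]_d -> R) : R :=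
  surface_integral angle_range (polar 1) f.

Definition sphere_area : R := sphere_integral (fun=> 1).

Definition sphere_dot (f g : 'rV[R]_d -> R) : R :=
  sphere_area^-1 * sphere_integral (fun x => f x * g x).

End Polar.

Section SphericalHarmonics.
Context {R : realType} (d : nat).
Implicit Types (alpha : d.-tuple nat) (theta : 'rV[R]_d.-1).

(* alpha_j, for 1 <= j <= d. *)
Definition idx alpha (j : nat) : nat := nth 0%N alpha j.-1.

Definition deg alpha : nat := (\sum_(1 <= j < d.+1) idx alpha j)%N.

(* |alpha^j|. A sine, marked by alpha_d = 1, has frequency alpha_(d-1) + 1 in
   [gfun], and alpha_d is counted here. With frequency alpha_(d-1) and the sum
   stopping at alpha_(d-1), the function would vanish for alpha_(d-1) = 0, and
   otherwise have angular degree |alpha| - 1, so that multiplying by r^|alpha|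
   would not give a polynomial. *)
Definition tail_deg alpha (j : nat) : nat :=
  (\sum_(j <= i < d.+1) idx alpha i)%N.

Definition gfun alpha (t : R) : R :=
  if idx alpha d == 0%N then cos ((idx alpha d.-1)%:R * t)
  else sin ((idx alpha d.-1).+1%:R * t).

Definition lambda alpha (j : nat) : R :=
  (tail_deg alpha j.+1)%:R + (d%:R - j%:R - 1) / 2.

Definition bfac alpha : R :=
  if (0 < idx alpha d.-1 + idx alpha d)%N then 2 else 1.

Definition hfac_sqr alpha : R :=
  bfac alpha * \prod_(1 <= j < d.-1)
    ((idx alpha j)`!%:R *
       pochhammer ((d%:R - j%:R + 1) / 2) (tail_deg alpha j.+1) *
       ((idx alpha j)%:R + lambda alpha j) /
     (pochhammer (2 * lambda alpha j) (idx alpha j) *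
       pochhammer ((d%:R - j%:R) / 2) (tail_deg alpha j.+1) *
       lambda alpha j)).

Definition hfac alpha : R := Num.sqrt (hfac_sqr alpha).

(* [hfac_sqr] is the reciprocal of the mean square over the sphere of the other
   factors, so the normalized function is obtained by multiplying by [hfac], not
   by its inverse: for d = 3 and alpha = (1, 0, 0) those factors are x_3, of mean
   square 1/3, and [hfac_sqr] is 3. *)
Definition Y_polar alpha (r : R) theta : R :=
  hfac alpha * r ^+ deg alpha * gfun alpha (angle theta 1) *
  \prod_(1 <= j < d.-1)
    (sin (angle theta (d - j)) ^+ tail_deg alpha j.+1 *
     gegenbauer (lambda alpha j) (idx alpha j) (cos (angle theta (d - j)))).

Definition Y alpha (x : 'rV[R]_d) : R :=
  let p := xget (0, 0) (polar_coordinates x) in Y_polar alpha p.1 p.2.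

Definition Y_index (n : nat) : set (d.-tuple nat) :=
  [set alpha | deg alpha = n /\ (idx alpha d = 0%N \/ idx alpha d = 1%N)].

End SphericalHarmonics.

(* Main.v *)
Require Import Defs.
From HB Require Import structures.
From mathcomp Require Import all_boot all_order all_algebra.
From mathcomp Require Import all_classical all_reals all_analysis.
From mathcomp Require Import ring lra zify.
From mathcomp Require mpoly.

Set Implicit Arguments.
Unset Strict Implicit.
Unset Printing Implicit Defensive.

Import Order.TTheory GRing.Theory Num.Theory.
Import numFieldNormedType.Exports.
Import -(notations) mpoly.

Local Open Scope classical_set_scope.
Local Open Scope ring_scope.

(** The orthonormality is a computation in polar coordinates: the partial
    derivatives of the parametrization of the sphere are orthogonal, so the
    area density is the product of the [sin theta_k ^ (k-1)], and the inner
    product of two functions [Y_alpha] splits into one-dimensional integrals.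
    If [alpha <> beta], the angle attached to the last index where they differ
    contributes the inner product of two trigonometric functions of different
    frequencies, or of two Gegenbauer polynomials of different degrees with the
    same parameter, and this is zero.  The Gegenbauer norms follow by induction
    on the degree from the self-adjoint form of the differential equation and
    from (C_m^lam)' = 2 lam C_(m-1)^(lam+1).

    [Y_alpha] is the restriction of a polynomial: with
    rho_k^2 = x_1^2 + ... + x_k^2, the factor attached to the angle theta_(k-1)
    is rho_k^m C_m^lam(x_k / rho_k), and multiplication by it turns a harmonic
    polynomial in x_1, ..., x_(k-1) into a harmonic one in x_1, ..., x_k,
    because the recursion satisfied by the Gegenbauer coefficients makes the
    Laplacian telescope.

    The [Y_alpha] are linearly independent by orthonormality.  They span because
    a harmonic polynomial vanishes as soon as its coefficients at the monomials
    of degree at most 1 in the last variable do; of degree n, these monomials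
    are exactly the x^alpha with [alpha] in the index set, so the square matrix
    of the corresponding coefficients of the [Y_alpha] is invertible. *)

(** * Harmonic polynomials *)

Section HarmonicPolynomials.
Context {R : realType} {d : nat}.
Implicit Types (i j : 'I_d) (f g p q G H P : mpoly d R) (k m n s t : nat).

Local Notation Xv i := (mpolyX R (mnm1 i) : mpoly d R).

(** The Euler operator: [euler p = s%:R * p] expresses homogeneity of degree s in the form needed by
    the product rule for the Laplacian. *)
Definition euler p : mpoly d R := \sum_(i < d) Xv i * mderiv i p.

(** Indices start at 0, so this leaves the k + 1 variables x_0, ..., x_k; [rho2 k] below is the
    squared norm of exactly these. *)
Definition vars_le k p := forall j, (k < j)%N -> mderiv j p = 0.

Definition rho2 k : mpoly d R := \sum_(i < d | (i <= k)%N) Xv i ^+ 2.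

Lemma laplacian_is_linear : linear (@laplacian R d).
Proof.
move=> c p q; rewrite /laplacian scaler_sumr -big_split /=.
by apply: eq_bigr => i _; rewrite !linearP.
Qed.

HB.instance Definition _ :=
  GRing.isLinear.Build R (mpoly d R) (mpoly d R) _ (@laplacian R d)
    laplacian_is_linear.

Lemma laplacianM f g : laplacian (f * g) =
  laplacian f * g + 2 * (\sum_(i < d) mderiv i f * mderiv i g)
  + f * laplacian g.
Proof.
rewrite /laplacian !mulr_suml !mulr_sumr -!big_split /=.
apply: eq_bigr => i _; rewrite !(mderivM, mderivD) /=; ring.
Qed.

Lemma eulerM f g : euler (f * g) = euler f * g + f * euler g.
Proof.
rewrite /euler mulr_suml mulr_sumr -big_split /=.
apply: eq_bigr => i _; rewrite !mderivM /=; ring.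
Qed.

Lemma mderivXU i j : mderiv j (Xv i) = (i == j)%:R.
Proof.
rewrite mderivX mnm1E; case: eqP => [->|_]; last by rewrite scale0r.
rewrite scale1r (_ : mnm_sub _ _ = mnm0) ?mpolyX0 //.
by apply/mnmP => l; rewrite mnmBE mnm0E subnn.
Qed.

Lemma mderiv_exp j p n : mderiv j (p ^+ n) = n%:R * p ^+ n.-1 * mderiv j p.
Proof.
elim: n => [|n IH]; first by rewrite expr0 mul0r mul0r -mpolyC1 mderivC.
rewrite exprS mderivM IH /= -natr1; case: n {IH} => [|n]; first by rewrite /=; ring.
rewrite /= exprS; ring.
Qed.

Lemma mderiv_rho2 k j : mderiv j (rho2 k) = if (j <= k)%N then 2 * Xv j else 0.
Proof.
rewrite /rho2 raddf_sum /=.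
under eq_bigr do rewrite mderiv_exp mderivXU /= expr1.
case: ifPn => jk.
  rewrite (bigD1 j) //= eqxx mulr1 big1 ?addr0// => i /andP[_ /negPf ->].
  by rewrite mulr0.
rewrite big1 // => i ik; case: eqP => [eij|]; last by rewrite mulr0.
by rewrite -eij ik in jk.
Qed.

Lemma vars_leM k f g : vars_le k f -> vars_le k g -> vars_le k (f * g).
Proof. by move=> hf hg j jk; rewrite mderivM hf // hg // mul0r mulr0 addr0. Qed.

Lemma vars_le_exp k f n : vars_le k f -> vars_le k (f ^+ n).
Proof. by move=> hf j jk; rewrite mderiv_exp hf // mulr0. Qed.

Lemma vars_le_rho2 k : vars_le k (rho2 k).
Proof. by move=> j jk; rewrite mderiv_rho2 leqNgt jk. Qed.

Lemma vars_leX i : vars_le i (Xv i).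
Proof.
by move=> j ij; rewrite mderivXU; case: eqP => // e; rewrite e ltnn in ij.
Qed.

Lemma laplacian_rho2 k : (k < d)%N -> laplacian (rho2 k) = (2 * k.+1)%:R.
Proof.
move=> kd; rewrite /laplacian.
have E : \sum_(i < d) mderiv i (mderiv i (rho2 k))
       = \sum_(i < d | (i < k.+1)%N) (2 : mpoly d R).
  rewrite [RHS]big_mkcond /=; apply: eq_bigr => i _.
  rewrite mderiv_rho2 ltnS; case: ifP => _; last by rewrite linear0.
  by rewrite -mpolyC_nat mderiv_mulC mderivXU eqxx mulr1.
rewrite E -(big_ord_widen _ (fun _ => (2 : mpoly d R))) //.
by rewrite sumr_const card_ord natrM mulr_natr.
Qed.

(** The gradient of [rho2 k] is 2x on the variables on which G may depend, so the cross term of the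
    product rule is 4 times the Euler operator. *)
Lemma laplacian_rho2M k G : (k < d)%N -> vars_le k G ->
  laplacian (rho2 k * G) =
    (2 * k.+1)%:R * G + 4 * euler G + rho2 k * laplacian G.
Proof.
move=> kd hG; rewrite laplacianM laplacian_rho2 //; congr (_ + _ + _).
rewrite /euler !mulr_sumr; apply: eq_bigr => i _; rewrite mderiv_rho2.
case: ifPn => [_|]; first by ring.
by rewrite -ltnNge => /hG ->; rewrite !mulr0.
Qed.

Lemma euler_rho2 k : euler (rho2 k) = 2 * rho2 k.
Proof.
rewrite /euler /rho2 mulr_sumr [RHS]big_mkcond /=.
apply: eq_bigr => i _; rewrite -/(rho2 k) mderiv_rho2.
by case: ifP => _; [ring | rewrite mulr0].
Qed.

Lemma eulerX i : euler (Xv i) = Xv i.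
Proof.
rewrite /euler (bigD1 i) //= mderivXU eqxx mulr1 big1 ?addr0 // => j.
by rewrite mderivXU eq_sym => /negPf ->; rewrite mulr0.
Qed.

Lemma euler_exp p s n : euler p = s%:R * p ->
  euler (p ^+ n) = (n * s)%:R * p ^+ n.
Proof.
move=> hp; elim: n => [|n IH].
  rewrite expr0 mul0n mul0r /euler big1 // => i _.
  by rewrite -mpolyC1 mderivC mulr0.
rewrite exprS eulerM IH hp mulSn natrD; ring.
Qed.

(** Induction on n: one more factor [rho2 k] meets a polynomial of degree 2n + s, on which the Euler
    operator is a scalar. *)
Lemma laplacian_rho2XM k H s n : (k < d)%N -> vars_le k H ->
  euler H = s%:R * H -> laplacian (rho2 k ^+ n * H) =
    2 * n%:R * (2 * n%:R + k%:R - 1 + 2 * s%:R) * rho2 k ^+ n.-1 * H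
    + rho2 k ^+ n * laplacian H.
Proof.
move=> kd hH eH; elim: n => [|n IH].
  by rewrite !expr0 !mulr0 !mul0r add0r !mul1r.
have vH : vars_le k (rho2 k ^+ n * H).
  by apply: vars_leM => //; apply/vars_le_exp/vars_le_rho2.
rewrite exprS -mulrA laplacian_rho2M // IH eulerM eH (euler_exp _ (euler_rho2 k)).
case: n {IH vH} => [|n] /=; rewrite ?exprS ?expr0; ring.
Qed.

Lemma laplacian_XM i P n : mderiv i P = 0 -> laplacian P = 0 ->
  laplacian (Xv i ^+ n * P) = n%:R * (n%:R - 1) * Xv i ^+ n.-2 * P.
Proof.
move=> hi hP; rewrite laplacianM hP mulr0 addr0.
rewrite [X in 2 * X]big1 ?mulr0 ?addr0; last first.
  move=> j _; rewrite mderiv_exp mderivXU; case: eqP => [<-|_].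
    by rewrite hi mulr0.
  by rewrite mulr0 mul0r.
congr (_ * _); rewrite /laplacian (bigD1 i) //= big1 ?addr0; last first.
  by move=> j ji; rewrite mderiv_exp mderivXU eq_sym (negPf ji) mulr0 linear0.
rewrite mderiv_exp mderivXU eqxx mulr1 -mpolyC_nat mderiv_mulC mderiv_exp.
rewrite mderivXU eqxx mulr1; case: n => [|n] /=; first by rewrite mpolyC0 !mul0r.
rewrite mpolyC_nat; ring.
Qed.

(** The homogenization rho^m q(x_i / rho), with rho^2 = [rho2 i], of a one-variable polynomial q
    whose exponents drop from m in steps of two; so only even powers of rho occur. *)
Definition zonal_factor (c : nat -> R) i m : mpoly d R :=
  \sum_(j < (m./2).+1) c j *: (Xv i ^+ (m - j.*2) * rho2 i ^+ j).

Lemma zonal_factor_vars_le c i m : vars_le i (zonal_factor c i m).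
Proof.
move=> j ij; rewrite /zonal_factor raddf_sum /= big1 // => l _.
rewrite mderivZ (vars_leM _ _ ij) ?scaler0 //.
  exact/vars_le_exp/vars_leX.
exact/vars_le_exp/vars_le_rho2.
Qed.

Lemma euler_is_linear : linear euler.
Proof.
move=> c p q; rewrite /euler scaler_sumr -big_split /=.
by apply: eq_bigr => i _; rewrite linearP mulrDr scalerAr.
Qed.

HB.instance Definition _ :=
  GRing.isLinear.Build R (mpoly d R) (mpoly d R) _ euler euler_is_linear.

Lemma euler_zonal_factor c i m :
  euler (zonal_factor c i m) = m%:R * zonal_factor c i m.
Proof.
rewrite /zonal_factor linear_sum /= mulr_sumr; apply: eq_bigr => j _.
rewrite linearZ /= -scalerAr; congr (_ *: _).
have eX : euler (Xv i) = 1%:R * Xv i by rewrite eulerX mul1r.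
rewrite eulerM (euler_exp _ (euler_rho2 i)) (euler_exp _ eX).
rewrite muln1 natrB ?natrM -?muln2; last by have := ltn_ord j; lia.
rewrite natrM; ring.
Qed.

(** The Laplacian of the l-th term has two parts, and the second part for l carries the same
    monomial as the first part for l + 1. The recursion assumed for c says that these cancel. *)
Lemma zonal_factor_harmonic c i m t P : (forall j, (i <= j)%N -> mderiv j P = 0) ->
  laplacian P = 0 -> euler P = t%:R * P ->
  (forall l, (l.+1.*2 <= m)%N ->
     2 * l.+1%:R * (2 * (m%:R - l.+1%:R) + i%:R - 1 + 2 * t%:R) * c l.+1
     + (m%:R - l.*2%:R) * (m%:R - l.*2%:R - 1) * c l = 0) ->
  laplacian (zonal_factor c i m * P) = 0.
Proof.
move=> hP lP eP hc; rewrite /zonal_factor mulr_suml linear_sum /=.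
have vP : vars_le i P by move=> j ij; apply: hP; exact: ltnW.
(* [A] comes from differentiating the power of [rho2 i], [B] from differentiating the power of
   x_i. *)
pose A (l : nat) : mpoly d R := (2 * l%:R * (2 * (m%:R - l%:R) + i%:R - 1 + 2 * t%:R) * c l)
   *: (rho2 i ^+ l.-1 * Xv i ^+ (m - l.*2) * P).
pose B (l : nat) : mpoly d R := ((m%:R - l.*2%:R) * (m%:R - l.*2%:R - 1) * c l)
   *: (rho2 i ^+ l * Xv i ^+ (m - l.*2).-2 * P).
have eX : euler (Xv i) = 1%:R * Xv i by rewrite eulerX mul1r.
have E (l : 'I_(m./2).+1) : laplacian (c l *: (Xv i ^+ (m - l.*2) * rho2 i ^+ l) * P)
    = A l + B l.
  have lm : (l.*2 <= m)%N by have := ltn_ord l; lia.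
  rewrite -scalerAl linearZ /= [in LHS](mulrC (Xv i ^+ _)) -mulrA.
  rewrite (@laplacian_rho2XM _ _ (m - l.*2 + t)) //; first last.
  - rewrite eulerM (euler_exp _ eX) eP muln1 natrD; ring.
  - by apply: vars_leM => //; apply/vars_le_exp/vars_leX.
  rewrite laplacian_XM ?hP // /A /B scalerDr; congr (_ + _).
    rewrite -[2 * _ * (_ + _) * c l]mulrC -scalerA; congr (_ *: _).
    rewrite -[RHS]mul_mpolyC !(mpolyCM, mpolyCD, mpolyCB, mpolyC_nat, mpolyCN, mpolyC1).
    rewrite natrD natrB // -muln2 natrM; ring.
  rewrite [_ * c l]mulrC -scalerA; congr (_ *: _).
  rewrite -[RHS]mul_mpolyC !(mpolyCM, mpolyCD, mpolyCB, mpolyC_nat, mpolyCN, mpolyC1).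
  rewrite natrB //; ring.
rewrite (eq_bigr (fun l : 'I__ => A l + B l)) // big_split /=.
rewrite big_ord_recl big_ord_recr /=.
have -> : A 0 = 0 by rewrite /A mulr0 !mul0r scale0r.
(* The exponent of x_i left at l = [m./2] is 0 or 1, so its second derivative vanishes. *)
have -> : B m./2 = 0.
  rewrite /B (_ : m%:R - (m./2).*2%:R = (odd m)%:R :> R); last first.
    by rewrite -{1}(odd_double_half m) natrD addrK.
  by case: odd; rewrite ?subrr ?mulr0 ?mul0r scale0r.
rewrite add0r addr0 -big_split /= big1 // => l _.
rewrite /A /B /bump /= add1n.
rewrite (_ : (m - (l.*2).+2 = (m - l.*2).-2)%N); last by lia.
rewrite -scalerDl hc ?scale0r //.
by have := ltn_ord l; lia.
Qed.

End HarmonicPolynomials.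

(** * The recursion of the Gegenbauer coefficients *)

Section GegenbauerCoefficients.
Context {R : realType}.
Implicit Types (lam : R) (m l : nat).

Definition gegenbauer_coef lam m l : R :=
  pochhammer lam m * 2 ^+ m / m`!%:R *
  (pochhammer (- (m%:R / 2)) l * pochhammer ((1 - m%:R) / 2) l /
   (l`!%:R * pochhammer (1 - m%:R - lam) l)).

Lemma gegenbauerE lam m (t : R) : gegenbauer lam m t =
  \sum_(l < (m./2).+1) gegenbauer_coef lam m l * t ^+ (m - l.*2).
Proof.
by rewrite /gegenbauer mulr_sumr; apply: eq_bigr => l _; rewrite mulrA.
Qed.

Lemma pochhammerS (a : R) k : pochhammer a k.+1 = pochhammer a k * (a + k%:R).
Proof. by rewrite /pochhammer big_ord_recr. Qed.

Lemma pochhammer0 (a : R) : pochhammer a 0 = 1.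
Proof. by rewrite /pochhammer big_ord0. Qed.

(** Each factor 1 - m - lam + i with i < l is at most -lam, hence negative. *)
Lemma gegenbauer_pochhammer_neq0 lam m l : 0 < lam -> (l.*2 <= m)%N ->
  pochhammer (1 - m%:R - lam) l != 0.
Proof.
move=> l0 lm; rewrite /pochhammer prodf_seq_neq0; apply/allP => i _ /=.
have : i.+1%:R <= m%:R :> R by rewrite ler_nat; have := ltn_ord i; lia.
rewrite -natr1 => h; apply/eqP => e; lra.
Qed.

(** Used twice: for the harmonicity of zonal factors, where 2 lam = i - 1 + 2t, and for the
    Gegenbauer differential equation. *)
Lemma gegenbauer_coefS lam m l : 0 < lam -> (l.+1.*2 <= m)%N ->
  2 * l.+1%:R * (2 * (m%:R - l.+1%:R) + 2 * lam) * gegenbauer_coef lam m l.+1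
  + (m%:R - l.*2%:R) * (m%:R - l.*2%:R - 1) * gegenbauer_coef lam m l = 0.
Proof.
move=> l0 lm; have p1 := gegenbauer_pochhammer_neq0 l0 lm.
have p2 : pochhammer (1 - m%:R - lam) l != 0.
  by apply: gegenbauer_pochhammer_neq0 => //; lia.
have f0 : l`!%:R != 0 :> R by rewrite pnatr_eq0 -lt0n fact_gt0.
have f1 : l.+1%:R != 0 :> R by rewrite pnatr_eq0.
have f2 : m`!%:R != 0 :> R by rewrite pnatr_eq0 -lt0n fact_gt0.
move: p1; rewrite /gegenbauer_coef !pochhammerS factS natrM mulf_eq0 negb_or.
move=> /andP[_ p3]; have E : l.+1%:R = l%:R + 1 :> R by rewrite natr1.
rewrite -muln2 natrM E; rewrite E in f1.
by field; rewrite f0 f1 f2 p2 p3.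
Qed.

End GegenbauerCoefficients.

(** * Harmonic polynomials in the first two variables *)

Section CircularPolynomials.
Context {R : realType} {d : nat} (o0 o1 : 'I_d).
Context (o01 : o0 != o1).
Implicit Types (n : nat) (j : 'I_d).
Local Notation Xv i := (mpolyX R (mnm1 i) : mpoly d R).

(* Real and imaginary part of (x_2 + i x_1)^n. *)
Fixpoint circ n : mpoly d R * mpoly d R :=
  if n is n'.+1 then
    let: (a, b) := circ n' in (Xv o1 * a - Xv o0 * b, Xv o1 * b + Xv o0 * a)
  else (1, 0).

Lemma circS1 n : (circ n.+1).1 = Xv o1 * (circ n).1 - Xv o0 * (circ n).2.
Proof. by rewrite /=; case: circ. Qed.

Lemma circS2 n : (circ n.+1).2 = Xv o1 * (circ n).2 + Xv o0 * (circ n).1.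
Proof. by rewrite /=; case: circ. Qed.

(** With z = x_2 + i x_1, the derivatives of z^n in x_2 and x_1 are n z^(n-1) and i n z^(n-1). For n
    = 0 the factor n makes the truncated predecessor harmless. *)
Lemma mderiv_circ n :
  [/\ mderiv o1 (circ n).1 = n%:R * (circ n.-1).1,
      mderiv o1 (circ n).2 = n%:R * (circ n.-1).2,
      mderiv o0 (circ n).1 = - (n%:R * (circ n.-1).2)
    & mderiv o0 (circ n).2 = n%:R * (circ n.-1).1].
Proof.
elim: n => [|n [h1 h2 h3 h4]].
  by rewrite /= -mpolyC1 -mpolyC0 !mderivC mpolyC0 !mul0r oppr0.
have e01 : (o0 == o1) = false by apply: negbTE.
have e10 : (o1 == o0) = false by rewrite eq_sym.
rewrite circS1 circS2 !(mderivB, mderivD, mderivM, mderivXU) h1 h2 h3 h4.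
rewrite !eqxx e01 e10 (_ : n.+1%:R = n%:R + 1) ?natr1 //.
case: n {h1 h2 h3 h4} => [|n] /=; first by split; ring.
have -> : (let: (a, b) := circ n in (Xv o1 * a - Xv o0 * b, Xv o1 * b + Xv o0 * a))
   = circ n.+1 by [].
rewrite circS1 circS2; split; ring.
Qed.

Lemma mderiv_circ_other n j : j != o0 -> j != o1 ->
  mderiv j (circ n).1 = 0 /\ mderiv j (circ n).2 = 0.
Proof.
move=> j0 j1; elim: n => [|n [h1 h2]].
  by rewrite /= -mpolyC1 -mpolyC0 !mderivC mpolyC0.
rewrite circS1 circS2 !(mderivB, mderivD, mderivM, mderivXU) h1 h2.
rewrite (eq_sym o1) (eq_sym o0) (negPf j1) (negPf j0) mulr0n; split; ring.
Qed.

Lemma sum_two (F : 'I_d -> mpoly d R) :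
  (forall j, j != o0 -> j != o1 -> F j = 0) -> \sum_j F j = F o0 + F o1.
Proof.
move=> h; rewrite (bigD1 o0) //= (bigD1 o1) /=; last by rewrite eq_sym.
by rewrite big1 ?addr0// => i /andP[]; exact: h.
Qed.

(** The two second derivatives of z^n differ by the factor i^2 = -1. *)
Lemma laplacian_circ n :
  laplacian (circ n).1 = 0 /\ laplacian (circ n).2 = 0.
Proof.
rewrite /laplacian !sum_two; first last.
- by move=> j j0 j1; have [-> _] := mderiv_circ_other n j0 j1; rewrite linear0.
- by move=> j j0 j1; have [_ ->] := mderiv_circ_other n j0 j1; rewrite linear0.
have [-> -> -> ->] := mderiv_circ n; rewrite mderivN -!mpolyC_nat !mderiv_mulC.
have [-> -> -> ->] := mderiv_circ n.-1; split; ring.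
Qed.

Lemma euler_circ n : euler (circ n).1 = n%:R * (circ n).1 /\
  euler (circ n).2 = n%:R * (circ n).2.
Proof.
rewrite /euler !sum_two; first last.
- by move=> j j0 j1; have [-> _] := mderiv_circ_other n j0 j1; rewrite mulr0.
- by move=> j j0 j1; have [_ ->] := mderiv_circ_other n j0 j1; rewrite mulr0.
have [-> -> -> ->] := mderiv_circ n; case: n => [|n]; first by split; ring.
rewrite circS1 circS2 /=; split; ring.
Qed.

Lemma circ_homog n : ((circ n).1 \is ishomog1 n mdeg) &&
  ((circ n).2 \is ishomog1 n mdeg).
Proof.
have hX i : Xv i \is ishomog1 1 mdeg by rewrite dhomogX /= mdeg1.
elim: n => [|n /andP[h1 h2]]; first by rewrite dhomog1 dhomog0.
rewrite circS1 circS2 -add1n; apply/andP; split.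
  by rewrite rpredB //; apply: dhomogM.
by rewrite rpredD //; apply: dhomogM.
Qed.

(** De Moivre's formula: here x_2 + i x_1 is rho e^(it). *)
Lemma meval_circ n (v : 'I_d -> R) (rho t : R) :
  v o0 = rho * sin t -> v o1 = rho * cos t ->
  meval v (circ n).1 = rho ^+ n * cos (n%:R * t) /\
  meval v (circ n).2 = rho ^+ n * sin (n%:R * t).
Proof.
move=> h0 h1; elim: n => [|n [IH1 IH2]].
  by rewrite /= mul0r cos0 sin0 meval1 meval0 mulr0 mulr1.
rewrite circS1 circS2 mevalB mevalD !mevalM IH1 IH2 !mevalXU h0 h1.
rewrite -natr1 mulrDl mul1r cosD sinD exprS; split; ring.
Qed.

End CircularPolynomials.

(** * The harmonic polynomials that restrict to the functions [Y] *)

Section SolidHarmonics.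
Context {R : realType} {d : nat} (hd : (2 < d)%N).
Implicit Types (alpha : d.-tuple nat) (n : nat) (theta : 'rV[R]_d.-1) (i j : 'I_d).

Let o0 : 'I_d := Ordinal (ltn_trans (ltn0Sn 1) hd).
Let o1 : 'I_d := Ordinal (ltn_trans (ltnSn 1) hd).

(** The sine takes the exponent one larger, so that the degree is alpha_(d-1) + alpha_d in both
    cases. *)
Definition circ_factor alpha : mpoly d R :=
  if idx alpha d == 0%N then (circ o0 o1 (idx alpha d.-1)).1
  else (circ o0 o1 (idx alpha d.-1).+1).2.

(** The coordinate with 0-based index i carries the cosine of theta_i, and theta_(d-j) goes with
    alpha_j; hence the index d - i. *)
Definition zonal alpha i : mpoly d R :=
  zonal_factor (gegenbauer_coef (lambda alpha (d - i)) (idx alpha (d - i)))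
    i (idx alpha (d - i)).

Definition solid alpha n : mpoly d R :=
  circ_factor alpha * \prod_(i < d | (2 <= i < n)%N) zonal alpha i.

(* Degree of [solid alpha n], the part of the product in x_1, ..., x_n. *)
Definition sdeg alpha n := tail_deg alpha (d - n).+1.

Lemma sdegS alpha n : (n < d)%N ->
  sdeg alpha n.+1 = (idx alpha (d - n) + sdeg alpha n)%N.
Proof.
move=> nd; rewrite /sdeg /tail_deg (_ : (d - n.+1).+1 = (d - n)%N); last by lia.
by rewrite big_ltn //; lia.
Qed.

Lemma sdeg2 alpha : sdeg alpha 2 = (idx alpha d.-1 + idx alpha d)%N.
Proof.
rewrite /sdeg /tail_deg (_ : (d - 2).+1 = d.-1); last by lia.
rewrite big_ltn; last by lia.
by rewrite (_ : d.-1.+1 = d) ?big_nat1 //; lia.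
Qed.

Lemma sdeg_full alpha : sdeg alpha d = deg alpha.
Proof. by rewrite /sdeg subnn. Qed.

Lemma lambda_sdeg alpha i :
  lambda alpha (d - i) = (sdeg alpha i)%:R + (i%:R - 1) / 2 :> R.
Proof.
rewrite /lambda /sdeg natrB; last by exact: ltnW.
by congr (_ + _ / _); ring.
Qed.

Lemma lambda_gt0 alpha i : (2 <= i)%N -> 0 < lambda alpha (d - i) :> R.
Proof.
move=> i2; rewrite lambda_sdeg.
have : 0 <= (sdeg alpha i)%:R :> R by [].
have : 2 <= i%:R :> R by rewrite ler_nat.
lra.
Qed.

Lemma prod_solidS (F : 'I_d -> mpoly d R) n (nd : (n < d)%N) : (2 <= n)%N ->
  \prod_(i < d | (2 <= i < n.+1)%N) F i =
  F (Ordinal nd) * \prod_(i < d | (2 <= i < n)%N) F i.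
Proof.
move=> n2; rewrite (bigD1 (Ordinal nd)) /=; last by rewrite n2 ltnS leqnn.
by congr (_ * _); apply: eq_bigl => i; rewrite -val_eqE /=; lia.
Qed.

Lemma solidS alpha n (nd : (n < d)%N) : (2 <= n)%N ->
  solid alpha n.+1 = zonal alpha (Ordinal nd) * solid alpha n.
Proof. by move=> n2; rewrite /solid prod_solidS // mulrCA. Qed.

Lemma solid2 alpha : solid alpha 2 = circ_factor alpha.
Proof.
rewrite /solid big1 ?mulr1 // => i h; suff: false by []; lia.
Qed.

(** The three properties are proved together because multiplying by the next zonal factor keeps
    harmonicity only for a homogeneous harmonic polynomial free of the new variable. *)
Lemma solid_harmonic alpha n : (idx alpha d <= 1)%N -> (2 <= n <= d)%N ->
  [/\ forall j, (n <= j)%N -> mderiv j (solid alpha n) = 0,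
      laplacian (solid alpha n) = 0
    & euler (solid alpha n) = (sdeg alpha n)%:R * solid alpha n].
Proof.
move=> ad; elim: n => // n IH /andP[n2 nd].
have [e|n1] := eqVneq n 1%N.
  have o01 : o0 != o1 by [].
  rewrite e solid2 sdeg2 /circ_factor; split.
  - move=> j j2.
    have j0 : j != o0 by apply/eqP => ej; rewrite ej in j2.
    have j1 : j != o1 by apply/eqP => ej; rewrite ej in j2.
    by case: ifP => _; [have [] := @mderiv_circ_other R d o0 o1 (idx alpha d.-1) j j0 j1
      | have [] := @mderiv_circ_other R d o0 o1 (idx alpha d.-1).+1 j j0 j1].
  - by case: ifP => _; [have [] := @laplacian_circ R d o0 o1 o01 (idx alpha d.-1)
      | have [] := @laplacian_circ R d o0 o1 o01 (idx alpha d.-1).+1].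
  - have [h _] := @euler_circ R d o0 o1 o01 (idx alpha d.-1).
    have [_ h'] := @euler_circ R d o0 o1 o01 (idx alpha d.-1).+1.
    case: eqP ad => [->|]; first by rewrite addn0.
    by case: (idx _ d) => // -[] // _ _; rewrite addn1.
have {}n2 : (2 <= n)%N by lia.
have [|hP lP eP] := IH; first by rewrite n2 ltnW.
rewrite (solidS _ nd) //; split.
- move=> j nj; rewrite mderivM hP ?mulr0 ?addr0; last exact: ltnW.
  by rewrite (@zonal_factor_vars_le R d) ?mul0r.
- apply: (@zonal_factor_harmonic R d _ _ _ (sdeg alpha n)) => //= l ll.
  have := gegenbauer_coefS (@lambda_gt0 alpha (Ordinal nd) n2) ll.
  rewrite lambda_sdeg /=; move=> h; rewrite -[RHS]h; congr (_ * _ + _).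
  by field.
- have eZ : euler (zonal alpha (Ordinal nd)) =
      (idx alpha (d - n))%:R * zonal alpha (Ordinal nd).
    exact: euler_zonal_factor.
  rewrite eulerM eP eZ sdegS // natrD.
  move: (zonal _ _) (solid _ _) => z s; ring.
Qed.

Lemma solid_homog alpha n : (idx alpha d <= 1)%N -> (2 <= n <= d)%N ->
  solid alpha n \is ishomog1 (sdeg alpha n) mdeg.
Proof.
move=> ad; elim: n => // n IH /andP[n2 nd].
have [e|n1] := eqVneq n 1%N.
  rewrite e solid2 sdeg2 /circ_factor.
  have /andP[h _] := circ_homog o0 o1 (idx alpha d.-1) (R := R).
  have /andP[_ h'] := circ_homog o0 o1 (idx alpha d.-1).+1 (R := R).
  case: eqP ad => [->|]; first by rewrite addn0.
  by case: (idx _ d) => // -[] // _ _; rewrite addn1.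
have {}n2 : (2 <= n)%N by lia.
rewrite (solidS _ nd) // sdegS //; apply: dhomogM; last first.
  by apply: IH; rewrite n2 ltnW.
rewrite /zonal /zonal_factor /=; set m := idx alpha _.
rewrite rpred_sum // => l _; apply: dhomogZ.
have hX i : (mpolyX R (mnm1 i) : mpoly d R) \is ishomog1 1 mdeg by rewrite dhomogX /= mdeg1.
have -> : ishomog1 m mdeg = ishomog1 (1 * (m - l.*2) + 2 * l)%N mdeg
    :> qualifier 0 (mpoly d R).
  by congr ishomog1; have := ltn_ord l; lia.
apply: dhomogM; apply: dhomogMn => //; apply: rpred_sum => i _; exact: (dhomogMn 2 (hX i)).
Qed.

(** Up to sign, the norm of (x_1, ..., x_n) for 0 < n <= d. *)
Definition rho (r : R) theta n : R := r * \prod_(n <= j < d) sin (angle theta j).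

Lemma rhoE r theta n : (n < d)%N ->
  rho r theta n = rho r theta n.+1 * sin (angle theta n).
Proof. by move=> nd; rewrite /rho big_ltn //; ring. Qed.

Lemma polarE r theta i : polar r theta 0 i =
  rho r theta i.+1 * (if i == 0%N :> nat then 1 else cos (angle theta i)).
Proof. by rewrite mxE /rho; ring. Qed.

Local Notation at_polar r theta := (meval (fun i : 'I_d => polar r theta 0 i)).

Lemma meval_rho2 r theta k : (k < d)%N ->
  at_polar r theta (rho2 k) = rho r theta k.+1 ^+ 2.
Proof.
move=> kd; rewrite /rho2 raddf_sum /=.
under eq_bigr do rewrite rmorphXn /= mevalXU.
elim: k kd => [|k IH] kd.
  rewrite (big_pred1 o0) ?polarE ?mulr1 // => i.
  by rewrite leqn0.
rewrite (bigD1 (Ordinal kd)) //=.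
rewrite (eq_bigl (fun i : 'I_d => (i <= k)%N)); last first.
  by move=> i; rewrite -val_eqE /=; lia.
rewrite IH; last exact: ltnW.
rewrite polarE /= (rhoE _ _ kd) !exprMn -mulrDr addrC.
by rewrite [X in _ * X]addrC cos2Dsin2 mulr1.
Qed.

Lemma meval_zonal alpha r theta i : (0 < i)%N ->
  at_polar r theta (zonal alpha i) = rho r theta i.+1 ^+ idx alpha (d - i) *
   gegenbauer (lambda alpha (d - i)) (idx alpha (d - i)) (cos (angle theta i)).
Proof.
move=> i0; rewrite gegenbauerE mulr_sumr /zonal /zonal_factor raddf_sum /=.
apply: eq_bigr => l _; rewrite mevalZ mevalM !rmorphXn /= mevalXU meval_rho2 //.
rewrite polarE; have -> : (nat_of_ord i == 0%N) = false by lia.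
move: (ltn_ord l); set m := idx _ _ => lm.
rewrite exprMn -exprM [in RHS]mulrCA; congr (_ * _).
rewrite mulrAC -exprD; congr (_ ^+ _ * _); lia.
Qed.

Lemma meval_circ_factor alpha r theta : (idx alpha d <= 1)%N ->
  at_polar r theta (circ_factor alpha) =
  rho r theta 2 ^+ sdeg alpha 2 * gfun alpha (angle theta 1).
Proof.
move=> ad; have h0 : polar r theta 0 o0 = rho r theta 2 * sin (angle theta 1).
  by rewrite polarE /= mulr1 rhoE //; exact: ltnW.
have h1 : polar r theta 0 o1 = rho r theta 2 * cos (angle theta 1).
  by rewrite polarE.
rewrite /circ_factor /gfun sdeg2.
have [e1 _] := meval_circ (idx alpha d.-1) h0 h1.
have [_ e2] := meval_circ (idx alpha d.-1).+1 h0 h1.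
case: eqP ad => [->|]; first by rewrite addn0.
by case: (idx _ d) => // -[] // _ _; rewrite addn1.
Qed.

(** Passing from n to n + 1 rewrites rho_n as rho_(n+1) sin theta_n: this produces the powers of the
    sines, while the powers of rho_(n+1) collect into the new degree. *)
Lemma meval_solid alpha r theta n : (idx alpha d <= 1)%N -> (2 <= n <= d)%N ->
  at_polar r theta (solid alpha n) =
  rho r theta n ^+ sdeg alpha n * gfun alpha (angle theta 1) *
  \prod_(2 <= i < n) (sin (angle theta i) ^+ sdeg alpha i *
    gegenbauer (lambda alpha (d - i)) (idx alpha (d - i)) (cos (angle theta i))).
Proof.
move=> ad; elim: n => // n IH /andP[n2 nd].
have [->|n1] := eqVneq n 1%N.
  by rewrite solid2 meval_circ_factor // big_geq // mulr1.
have {}n2 : (2 <= n)%N by lia.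
rewrite (solidS _ nd) // mevalM meval_zonal /=; last by lia.
rewrite IH; last by rewrite n2 ltnW.
rewrite big_nat_recr //= (rhoE _ _ nd) [(rho _ _ _ * sin _) ^+ _]exprMn sdegS // exprD.
move: (\prod_(2 <= i < n) _) => Q; move: (gegenbauer _ _ _) => C.
move: (rho _ _ _ ^+ _) (rho _ _ _ ^+ _) (sin _ ^+ _) (gfun _ _) => x y z w.
ring.
Qed.

Definition solid_harm alpha : mpoly d R := hfac alpha *: solid alpha d.

Lemma prod_rev_index (F : nat -> R) :
  \prod_(1 <= j < d.-1) F (d - j)%N = \prod_(2 <= i < d) F i.
Proof.
rewrite big_add1 [RHS]big_add1 [RHS]big_add1 /= big_nat_rev /= !big_nat.
by apply: eq_bigr => i hi; congr F; lia.
Qed.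

Lemma Y_polarE alpha r theta : Y_polar alpha r theta =
  hfac alpha * r ^+ deg alpha * gfun alpha (angle theta 1) *
  \prod_(2 <= i < d) (sin (angle theta i) ^+ sdeg alpha i *
    gegenbauer (lambda alpha (d - i)) (idx alpha (d - i)) (cos (angle theta i))).
Proof.
rewrite /Y_polar -prod_rev_index; congr (_ * _).
rewrite !big_nat; apply: eq_bigr => i hi; rewrite /sdeg.
by rewrite (_ : (d - (d - i) = i)%N) //; lia.
Qed.

Lemma meval_solid_harm alpha r theta : (idx alpha d <= 1)%N ->
  at_polar r theta (solid_harm alpha) = Y_polar alpha r theta.
Proof.
move=> ad; rewrite mevalZ meval_solid //; last by rewrite leqnn ltnW.
by rewrite Y_polarE sdeg_full /rho big_geq // mulr1 !mulrA.
Qed.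

End SolidHarmonics.

(** * Uniqueness of harmonic polynomials *)

Section HarmonicUniqueness.
Context {R : realType} {d : nat}.

(** Strong induction on the exponent of x_l. If it is a >= 2 in m, then at m / x_l^2 the Laplacian
    has a (a - 1) times the coefficient at m, plus multiples of coefficients whose exponent of x_l
    is a - 2. *)
Lemma harmonic_eq0 (p : mpoly d R) (l : 'I_d) : laplacian p = 0 ->
  (forall m : multinom d, (m l <= 1)%N -> mcoeff m p = 0) -> p = 0.
Proof.
move=> lp hp; apply/mpolyP => m; rewrite mcoeff0.
have [k] := ubnP (m l); elim: k m => // k IH m; rewrite ltnS => mk.
have [/hp //|m1] := leqP (m l) 1.
pose m' := mnm_sub (mnm_sub m (mnm1 l)) (mnm1 l).
have eq_m : mnm_add (mnm_add m' (mnm1 l)) (mnm1 l) = m.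
  apply/mnmP => i; rewrite !mnmDE !mnmBE mnm1E.
  by case: eqP => [<-|_] /=; lia.
have : mcoeff m' (laplacian p) = 0 by rewrite lp mcoeff0.
rewrite /laplacian raddf_sum /= (bigD1 l) //= big1 => [|i il]; last first.
  rewrite !mcoeff_deriv IH ?mul0rn //.
  rewrite !mnmDE !mnmBE !mnm1E eqxx (negPf il) /=; lia.
rewrite addr0 !mcoeff_deriv eq_m => /eqP.
by rewrite -mulrnA mulrn_eq0 muln_eq0 /= => /eqP.
Qed.

End HarmonicUniqueness.

(** * The area density in polar coordinates *)

Section SphericalFrame.
Context {R : realType}.
Implicit Types (phi : nat -> R) (n k l i : nat).

(** The polar parametrization of the unit sphere, built one dimension at a time: the previous point
    scaled by the sine of the new angle, followed by its cosine. The first coordinate has no angle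
    of its own, hence the value 1. *)
Fixpoint sph phi n i : R :=
  if n is n'.+1 then
    if i == n' then (if n' == 0%N then 1 else cos (phi n'))
    else sin (phi n') * sph phi n' i
  else 0.

(* Derivative of [sph phi n i] in [phi k]. *)
Fixpoint dsph phi n k i : R :=
  if n is n'.+1 then
    if i == n' then (if k == n' then - sin (phi n') else 0)
    else if k == n' then cos (phi n') * sph phi n' i
    else sin (phi n') * dsph phi n' k i
  else 0.

Lemma sphE phi n i : (i < n)%N ->
  (if i == 0%N then 1 else cos (phi i)) * \prod_(i.+1 <= j < n) sin (phi j) =
  sph phi n i.
Proof.
elim: n => // n IH; rewrite ltnS leq_eqVlt => /predU1P[->|lin].
  by rewrite big_geq // mulr1 /= eqxx.
by rewrite big_nat_recr //= mulrA IH // mulrC (ltn_eqF lin).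
Qed.

Lemma dsph_geq phi n k i : (n <= k)%N -> dsph phi n k i = 0.
Proof.
elim: n => //= n IH nk; rewrite (gtn_eqF nk) IH ?mulr0; last exact: ltnW.
by case: ifP.
Qed.

Lemma sph_norm phi n : (0 < n)%N -> \sum_(i < n) sph phi n i ^+ 2 = 1.
Proof.
elim: n => // n IH _; rewrite big_ord_recr /= eqxx.
have [->|n0] := eqVneq n 0%N; first by rewrite big_ord0 expr1n add0r.
under eq_bigr => i _ do rewrite (ltn_eqF (ltn_ord i)) exprMn.
by rewrite -mulr_sumr IH ?lt0n // mulr1 addrC cos2Dsin2.
Qed.

(** The norm is constant, so a point of the sphere is orthogonal to its derivatives. *)
Lemma sph_dsph phi n k : (0 < k < n)%N ->
  \sum_(i < n) sph phi n i * dsph phi n k i = 0.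
Proof.
elim: n => [|n IH]; first by rewrite ltn0 andbF.
move=> /andP[k0]; rewrite ltnS leq_eqVlt => kn.
have n0 : (n == 0%N) = false by lia.
rewrite big_ord_recr /= eqxx n0.
under eq_bigr => i _ do rewrite (ltn_eqF (ltn_ord i)).
case/predU1P: kn => [->|kn].
  rewrite eqxx (eq_bigr (fun i : 'I_n =>
      sin (phi n) * cos (phi n) * sph phi n i ^+ 2));
    last by move=> i _; ring.
  rewrite -mulr_sumr sph_norm; [ring | lia].
rewrite (ltn_eqF kn) (eq_bigr (fun i : 'I_n =>
    sin (phi n) ^+ 2 * (sph phi n i * dsph phi n k i)));
    last by move=> i _; ring.
by rewrite -mulr_sumr IH ?k0 // !mulr0 addr0.
Qed.

(** With u the previous point, the new angle has derivative (cos u, -sin), of norm 1, and an older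
    one has (sin du, 0). They are orthogonal since u is orthogonal to du. *)
Lemma dsph_gram phi n k l : (0 < k < n)%N -> (0 < l < n)%N ->
  \sum_(i < n) dsph phi n k i * dsph phi n l i =
  (k == l)%:R * \prod_(k.+1 <= j < n) sin (phi j) ^+ 2.
Proof.
elim: n => [|n IH]; first by rewrite ltn0 andbF.
move=> /andP[k0]; rewrite ltnS leq_eqVlt => kn.
move=> /andP[l0]; rewrite ltnS leq_eqVlt => ln.
rewrite big_ord_recr /= eqxx.
under eq_bigr => i _ do rewrite (ltn_eqF (ltn_ord i)).
case/predU1P: kn => [ek|kn]; case/predU1P: ln => [el|ln].
- rewrite ek el !eqxx; rewrite (eq_bigr (fun i : 'I_n => cos (phi n) ^+ 2 * sph phi n i ^+ 2));
    last by move=> i _; ring.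
  rewrite -mulr_sumr sph_norm; last by lia.
  by rewrite big_geq // !mulr1 mulrNN -expr2 cos2Dsin2.
- rewrite ek eqxx (ltn_eqF ln) (gtn_eqF ln) mul0r mulr0 addr0.
  rewrite (eq_bigr (fun i : 'I_n =>
      cos (phi n) * sin (phi n) * (sph phi n i * dsph phi n l i)));
    last by move=> i _; ring.
  by rewrite -mulr_sumr sph_dsph ?l0 // mulr0.
- rewrite el eqxx (ltn_eqF kn) mul0r mul0r addr0.
  rewrite (eq_bigr (fun i : 'I_n =>
      cos (phi n) * sin (phi n) * (sph phi n i * dsph phi n k i)));
    last by move=> i _; ring.
  by rewrite -mulr_sumr sph_dsph ?k0 // mulr0.
rewrite (ltn_eqF kn) (ltn_eqF ln) mul0r addr0.
rewrite (eq_bigr (fun i : 'I_n => sin (phi n) ^+ 2 * (dsph phi n k i * dsph phi n l i)));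
    last by move=> i _; ring.
by rewrite -mulr_sumr IH ?k0 ?l0 // big_nat_recr //=; ring.
Qed.

(** F (i + 1) occurs in the inner product exactly for k < i, that is, i times. *)
Lemma prod_triangle (F : nat -> R) n :
  \prod_(k < n) \prod_(k.+2 <= j < n.+1) F j = \prod_(i < n) F i.+1 ^+ i.
Proof.
elim: n => [|n IH]; first by rewrite !big_ord0.
rewrite big_ord_recr /= [X in _ * X]big_geq // mulr1 [RHS]big_ord_recr /= -IH.
rewrite (eq_bigr (fun k : 'I_n => (\prod_(k.+2 <= j < n.+1) F j) * F n.+1)).
  by rewrite big_split /= prodr_const card_ord.
by move=> k _; rewrite big_nat_recr //= !ltnS.
Qed.

End SphericalFrame.

(** * The Jacobian of the parametrization *)

Section PolarJacobian.
Context {R : realType} {d : nat}.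
Implicit Types (theta v : 'rV[R]_d.-1) (k j : 'I_d.-1) (n : nat).

Lemma angleS theta j : angle theta j.+1 = theta 0 j.
Proof. by rewrite /angle /= valK. Qed.

Lemma angleE theta n : (0 < n < d)%N -> exists2 j : 'I_d.-1, n = j.+1 &
  angle theta n = theta 0 j.
Proof.
move=> nd; have h : (n.-1 < d.-1)%N by lia.
have E : n = (Ordinal h).+1 by rewrite /= prednK //; lia.
by exists (Ordinal h) => //; rewrite {1}E angleS.
Qed.

Lemma polar_sph theta (i : 'I_d) : polar 1 theta 0 i = sph (angle theta) d i.
Proof. by rewrite mxE mul1r sphE. Qed.

Lemma differentiable_angle n theta : (0 < n < d)%N ->
  differentiable (fun t : 'rV[R]_d.-1 => angle t n) theta.
Proof.
move=> nd; have [j -> _] := angleE theta nd.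
rewrite (_ : (fun t => _) = fun t : 'rV[R]_d.-1 => t 0 j).
  exact: differentiable_coord.
by apply/funext => t; rewrite angleS.
Qed.

Lemma differentiable_sph n (i : nat) theta : (n <= d)%N ->
  differentiable (fun t : 'rV[R]_d.-1 => sph (angle t) n i) theta.
Proof.
elim: n => [|n IH] nd /=; first exact: differentiable_cst.
have dS (f : R -> R) (g : R -> R) : (0 < n)%N ->
    (forall x : R, is_derive x 1 f (g x)) ->
    differentiable (fun t : 'rV[R]_d.-1 => f (angle t n)) theta.
  move=> n0 df; apply: (@differentiable_comp _ _ _ _
    (fun t : 'rV[R]_d.-1 => angle t n) f).
    by apply: differentiable_angle; rewrite n0.
  apply/derivable1_diffP; exact: (@ex_derive _ _ _ _ _ _ _ (df _)).
case: eqP => _; first case: eqP => n0.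
- exact: differentiable_cst.
- by apply: (dS cos (fun x => - sin x)) => //; lia.
(* There is no angle of index 0; its sine multiplies [sph _ 0 i], which is 0. *)
have [n0|n0] := leqP n 0.
  have -> : n = 0%N by lia.
  rewrite /= (_ : (fun t => _) = cst 0); first exact: differentiable_cst.
  by apply/funext => t; rewrite mulr0.
apply: differentiableM; first by apply: (dS sin cos).
exact/IH/ltnW.
Qed.

Lemma is_derive_coord v theta j :
  is_derive theta v (fun t : 'rV[R]_d.-1 => t 0 j) (v 0 j).
Proof.
have h := is_derive_id theta v.
have dv : derivable (id : 'rV[R]_d.-1 -> _) theta v by exact: ex_derive.
apply: DeriveDef; first exact: (derivable_mxP _ _ _).1 dv 0 j.
have := derive_mx dv; rewrite derive_val => /matrixP/(_ 0 j).
by rewrite mxE.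
Qed.

Lemma is_derive_comp1 (g : 'rV[R]_d.-1 -> R) (f : R -> R) theta v dg df :
  differentiable g theta -> is_derive theta v g dg -> is_derive (g theta) 1 f df ->
  is_derive theta v (fun t => f (g t)) (dg * df).
Proof.
move=> dfg hg hf.
have df1 : differentiable f (g theta).
  by apply/derivable1_diffP; exact: (@ex_derive _ _ _ _ _ _ _ hf).
have dfgc : differentiable (f \o g) theta by exact: differentiable_comp.
apply: DeriveDef; first exact: diff_derivable dfgc.
rewrite (deriveE _ dfgc) diff_comp //= -(deriveE _ dfg).
rewrite (@derive_val _ _ _ _ _ _ _ hg).
have -> : dg = dg *: (1 : R) by rewrite /GRing.scale /= mulr1.
rewrite linearZ /= /GRing.scale /= mulr1.
by rewrite -deriveE // (@derive_val _ _ _ _ _ _ _ hf).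
Qed.

Lemma is_derive_sph n (i : nat) k theta : (n <= d)%N ->
  is_derive theta (delta_mx 0 k) (fun t : 'rV[R]_d.-1 => sph (angle t) n i)
    (dsph (angle theta) n k.+1 i).
Proof.
elim: n => [|n IH] nd /=; first exact: is_derive_cst.
have hc : (0 < n)%N -> is_derive theta (delta_mx 0 k)
    (fun t : 'rV[R]_d.-1 => angle t n) (k.+1 == n)%:R.
  move=> n0; have [|j ej _] := @angleE theta n; first by rewrite n0.
  rewrite (_ : (fun t => _) = fun t : 'rV[R]_d.-1 => t 0 j); last first.
    by apply/funext => t; rewrite ej angleS.
  have := is_derive_coord (delta_mx 0 k) theta j.
  by rewrite mxE eqxx /= ej eqSS eq_sym.
have dS (f : R -> R) (g : R -> R) : (0 < n)%N ->
    (forall x : R, is_derive x 1 f (g x)) ->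
    is_derive theta (delta_mx 0 k) (fun t : 'rV[R]_d.-1 => f (angle t n))
      ((k.+1 == n)%:R * g (angle theta n)).
  move=> n0 df; apply: is_derive_comp1 (hc n0) (df _).
  by apply: differentiable_angle; rewrite n0.
case: eqP => _; first case: eqP => n0.
- rewrite n0 /=; exact: is_derive_cst.
- have n1 : (0 < n)%N by lia.
  apply: (is_derive_eq (dS cos (fun x => - sin x) n1 _)).
  by case: eqP => _; rewrite ?mul1r ?mul0r.
have [n0|n0] := leqP n 0.
  have -> : n = 0%N by lia.
  rewrite /= mulr0 (_ : (fun t => _) = cst 0); first exact: is_derive_cst.
  by apply/funext => t; rewrite mulr0.
apply: (is_derive_eq (is_deriveM (dS sin cos n0 _) (IH (ltnW nd)))).
rewrite /GRing.scale /=; case: eqP => [kn|_]; last by rewrite mul0r mulr0 addr0.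
by rewrite dsph_geq -?kn // mulr0 add0r mul1r mulrC.
Qed.

Lemma differentiable_polar theta : differentiable (polar 1) theta.
Proof.
rewrite (_ : polar 1 = fun t => \sum_(i < d) sph (angle t) d i *: delta_mx 0 i).
  rewrite (_ : (fun t => _) = \sum_(i < d) (fun t => sph (angle t) d i *: delta_mx 0 i)).
    apply: differentiable_sum => i; apply: differentiableZl.
    exact: differentiable_sph.
  by apply/funext => t; rewrite fct_sumE.
apply/funext => t; rewrite [LHS]row_sum_delta; apply: eq_bigr => i _.
by rewrite polar_sph.
Qed.

Lemma jacobian_polarE theta k (i : 'I_d) :
  jacobian (polar 1) theta k i = dsph (angle theta) d k.+1 i.
Proof.
have dp := differentiable_polar theta.
transitivity (('D_(delta_mx 0 k) (polar 1) theta : 'rV[R]_d) 0 i).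
  by rewrite deriveEjacobian // -rowE [RHS]mxE.
rewrite derive_mx; last exact: diff_derivable.
rewrite mxE; under [X in 'D__ X _]eq_fun => t do rewrite polar_sph.
by rewrite (@derive_val _ _ _ _ _ _ _ (is_derive_sph i k theta (leqnn d))).
Qed.

(** The Gram matrix is diagonal. The root of its determinant is an absolute value, removed because
    the sines are nonnegative on [0, pi]; the sine of theta_1 has exponent 0. *)
Lemma sqrt_det_polar theta : (1 < d)%N ->
  (forall j, (0 < j)%N -> 0 <= theta 0 j <= pi) ->
  Num.sqrt (\det (jacobian (polar 1) theta *m (jacobian (polar 1) theta)^T)) =
  \prod_(j < d.-1) sin (theta 0 j) ^+ j.
Proof.
move=> d1 hth.
have -> : jacobian (polar 1) theta *m (jacobian (polar 1) theta)^T =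
  diag_mx (\row_(k < d.-1) (\prod_(k.+2 <= j < d) sin (angle theta j)) ^+ 2).
  apply/matrixP => k l; rewrite mxE [RHS]mxE [X in _ = X *+ _]mxE.
  rewrite (eq_bigr (fun i : 'I_d => dsph (angle theta) d k.+1 i *
    dsph (angle theta) d l.+1 i)); last first.
    by move=> i _; rewrite [X in _ * X]mxE !jacobian_polarE.
  rewrite dsph_gram; [|have := ltn_ord k; lia | have := ltn_ord l; lia].
  rewrite eqSS prodrXl; case: (eqVneq k l) => [->|kl].
    by rewrite eqxx mul1r mulr1n.
  by rewrite (_ : (k == l :> nat) = false) ?mul0r ?mulr0n //; apply/negbTE.
rewrite det_diag; under eq_bigr => k _ do rewrite mxE.
rewrite prodrXl sqrtr_sqr.
have E : \prod_(k < d.-1) \prod_(k.+2 <= j < d) sin (angle theta j) =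
    \prod_(j < d.-1) sin (theta 0 j) ^+ j.
  have := prod_triangle (fun j : nat => sin (angle theta j)) d.-1.
  rewrite prednK; last by lia.
  by move=> ->; apply: eq_bigr => j _; rewrite angleS.
rewrite E ger0_norm //; apply: prodr_ge0 => j _.
case: (posnP j) => [->|j0]; first by rewrite expr0.
by apply/exprn_ge0/sin_ge0_pi/hth.
Qed.

End PolarJacobian.

(** * Every point has polar coordinates *)

Section PolarSurjective.
Context {R : realType}.
Implicit Types (phi : nat -> R) (r rho : R) (n i : nat).

Lemma eq_sph phi phi' n i : (forall j, (0 < j < n)%N -> phi j = phi' j) ->
  (i < n)%N -> sph phi n i = sph phi' n i.
Proof.
elim: n => // n IH h; rewrite ltnS leq_eqVlt => /predU1P[->|lin] /=.
  by rewrite eqxx; case: eqP => // n0; rewrite h ?ltnS ?leqnn ?andbT //; lia.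
rewrite (ltn_eqF lin) IH //; last by move=> j jn; apply: h; lia.
by rewrite h // ltnS leqnn andbT; lia.
Qed.

Lemma polar_plane rho (z : R) : 0 <= rho ->
  exists r a, [/\ 0 <= r, 0 <= a <= pi, rho = r * sin a & z = r * cos a].
Proof.
move=> rho0; set r := Num.sqrt (rho ^+ 2 + z ^+ 2).
have s0 : 0 <= rho ^+ 2 + z ^+ 2 by rewrite addr_ge0 ?sqr_ge0.
have r0 : 0 <= r by exact: sqrtr_ge0.
have rE : r ^+ 2 = rho ^+ 2 + z ^+ 2 by rewrite sqr_sqrtr.
(* At the origin any angle works, and 0 is taken; elsewhere the angle is acos (z / r). *)
have [e|rn0] := eqVneq r 0.
  have : rho ^+ 2 + z ^+ 2 == 0 by rewrite -rE e expr0n.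
  rewrite paddr_eq0 ?sqr_ge0 // !sqrf_eq0 => /andP[/eqP -> /eqP ->].
  by exists 0, 0; rewrite !mul0r lexx pi_ge0.
have rp : 0 < r by rewrite lt0r rn0.
have zr : (z / r) ^+ 2 = 1 - (rho / r) ^+ 2.
  by rewrite !expr_div_n rE; field; rewrite -rE expf_neq0.
have zb : -1 <= z / r <= 1.
  rewrite -ler_norml -(@ler_pXn2r _ 2) ?nnegrE // expr1n real_normK ?num_real //.
  by rewrite zr gerBl sqr_ge0.
exists r, (acos (z / r)); rewrite r0 acos_ge0 // acos_lepi //; split => //.
  rewrite sin_acos // zr opprB addrC subrK sqrtr_sqr ger0_norm ?divr_ge0 //.
  by rewrite mulrC divfK.
by rewrite acosK ?in_itv // mulrC divfK.
Qed.

(** Induction on the dimension: the radius of the first n coordinates and the next coordinate form a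
    point of a half-plane, whose polar angle in [0, pi] is the new angle. *)
Lemma sph_surj (y : nat -> R) n : (1 < n)%N -> exists r phi,
  [/\ 0 <= r, forall j, angle_range j (phi j.+1) &
      forall i, (i < n)%N -> y i = r * sph phi n i].
Proof.
elim: n => // n IH n1; have [e|n2] := eqVneq n 1%N.
  have [r [a [r0 a0 h1 h2]]] := polar_plane (y 1%N) (normr_ge0 (y 0%N)).
  (* The first angle runs over [0, 2 pi]: it is found for |y_0| and reflected when y_0 is
     negative. *)
  exists r, (fun j => if j == 1%N then (if 0 <= y 0%N then a else 2 * pi - a) else 0).
  split => // [[|j]|i]; rewrite /angle_range /= ?in_itv /= ?lexx ?pi_ge0 //.
    by case: ifP => _; lra.
  rewrite e; case: i => [|[|//]] _ /=.
    rewrite mulr1; case: ifP => y0; first by rewrite -h1 ger0_norm.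
    rewrite mulr_natl sinB sin2pi cos2pi mul0r mul1r sub0r mulrN -h1.
    rewrite ltr0_norm ?opprK //.
    by rewrite ltNge y0.
  by case: ifP => _ //; rewrite mulr_natl cosB sin2pi cos2pi mul0r mul1r addr0.
have [|r [phi [r0 hphi hy]]] := IH; first by lia.
have [r' [a [r'0 a0 h1 h2]]] := polar_plane (y n) r0.
exists r', (fun j => if j == n then a else phi j); split => //.
  move=> j; case: eqP => [e|_ //].
  by rewrite /angle_range (_ : (j == 0%N) = false) /= ?in_itv //; lia.
move=> i; rewrite ltnS leq_eqVlt => /predU1P[->|lin] /=.
  by rewrite !eqxx (_ : (n == 0%N) = false) //; lia.
rewrite (ltn_eqF lin) eqxx mulrA -h1 hy //; congr (_ * _).
by apply: eq_sph => // j jn; case: eqP => // ?; lia.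
Qed.

Lemma polar_coordinates_exist d (x : 'rV[R]_d) : (1 < d)%N ->
  exists p, polar_coordinates x p.
Proof.
move=> d1; pose y n := odflt 0 (omap (x 0) (insub n)).
have [r [phi [r0 hphi hy]]] := sph_surj y d1.
exists (r, \row_j phi j.+1); split => //= [j|]; first by rewrite mxE.
apply/rowP => i; rewrite mxE -mulrA sphE //.
have -> : x 0 i = y i by rewrite /y valK.
rewrite hy //; congr (_ * _); apply: eq_sph => // j jd.
by have [k -> ->] := angleE (\row_j phi j.+1) jd; rewrite mxE.
Qed.

End PolarSurjective.

(** * Iterated integrals of sums of products *)

Section BoxIntegrals.
Context {R : realType}.
Local Notation mu := (@lebesgue_measure R).

Lemma row_mx_cons0 m (t : R) (v : 'rV[R]_m) :
  (row_mx (t%:M : 'rV[R]_1) v : 'rV[R]_m.+1) 0 0 = t.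
Proof.
have -> : (0 : 'I_m.+1) = lshift m (0 : 'I_1) by apply: val_inj.
by rewrite (row_mxEl (t%:M : 'rV[R]_1) v) mxE eqxx.
Qed.

Lemma row_mx_consS m (t : R) (v : 'rV[R]_m) (i : 'I_m) :
  (row_mx (t%:M : 'rV[R]_1) v : 'rV[R]_m.+1) 0 (lift ord0 i) = v 0 i.
Proof.
have -> : lift ord0 i = rshift 1 i by apply: val_inj.
by rewrite (row_mxEr (t%:M : 'rV[R]_1) v).
Qed.

Lemma eq_box_integral m (D : nat -> set R) (F G : 'rV[R]_m -> R) :
  (forall u : 'rV[R]_m, (forall i : 'I_m, D i (u 0 i)) -> F u = G u) ->
  box_integral D F = box_integral D G.
Proof.
elim: m D F G => [|m IH] D F G FG /=; first by apply: FG => -[].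
apply: eq_Rintegral => t /set_mem Dt; apply: IH => v Dv; apply: FG => i.
have [j ->|->] := unliftP 0 i; first by rewrite row_mx_consS; exact: Dv.
by rewrite row_mx_cons0.
Qed.

Lemma integrable_Rsum (T : Type) (s : seq T) (D : set R) (g : T -> R -> R) :
  measurable D -> (forall x, mu.-integrable D (EFin \o g x)) ->
  mu.-integrable D (EFin \o (fun t => \sum_(x <- s) g x t)).
Proof.
move=> mD ig; have -> : EFin \o (fun t => \sum_(x <- s) g x t) =
    (fun t => \sum_(x <- s) (g x t)%:E)%E.
  by apply/funext => t /=; rewrite sumEFin.
by apply: integrable_sum => // x _; exact: ig.
Qed.

Lemma Rintegral_sum (T : Type) (s : seq T) (D : set R) (g : T -> R -> R) :
  measurable D -> (forall x, mu.-integrable D (EFin \o g x)) ->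
  (\int[mu]_(t in D) \sum_(x <- s) g x t)%R =
  \sum_(x <- s) (\int[mu]_(t in D) g x t)%R.
Proof.
move=> mD ig; elim: s => [|x s IH].
  rewrite big_nil; under eq_Rintegral do rewrite big_nil.
  by rewrite /Rintegral integral0.
rewrite big_cons -IH -RintegralD //; last exact: integrable_Rsum.
by apply: eq_Rintegral => t _; rewrite big_cons.
Qed.

(** The integral is iterated by definition, so the variables separate one at a time. Sums are
    allowed so that linear combinations can be integrated later. *)
Lemma box_integral_sum_prod (T : Type) (s : seq T) m (D : nat -> set R)
    (c : T -> R) (f : T -> nat -> R -> R) :
  (forall i, measurable (D i)) ->
  (forall x i, mu.-integrable (D i) (EFin \o f x i)) ->
  box_integral D (fun u : 'rV[R]_m => \sum_(x <- s) c x * \prod_(i < m) f x i (u 0 i))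
  = \sum_(x <- s) c x * \prod_(i < m) (\int[mu]_(t in D i) f x i t)%R.
Proof.
elim: m D c f => [|m IH] D c f mD If /=.
  by apply: eq_bigr => x _; rewrite !big_ord0.
transitivity (\int[mu]_(t in D 0) \sum_(x <- s)
    (c x * \prod_(i < m) (\int[mu]_(t in D i.+1) f x i.+1 t)%R) * f x 0 t)%R.
  apply: eq_Rintegral => t _.
  rewrite [RHS](eq_bigr (fun x => c x * f x 0 t *
    \prod_(i < m) (\int[mu]_(t in D i.+1) f x i.+1 t)%R)); last by move=> x _; ring.
  (* For a fixed value of the first variable, its factor joins the coefficient. *)
  rewrite -(IH (fun i => D i.+1) (fun x => c x * f x 0 t) (fun x i => f x i.+1)) //.
  apply: eq_box_integral => u _; apply: eq_bigr => x _.
  rewrite big_ord_recl row_mx_cons0 mulrA; congr (_ * _).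
  by apply: eq_bigr => i _; rewrite row_mx_consS.
rewrite Rintegral_sum //; last first.
  move=> x; set K := \prod_(i < m) _.
  have -> : EFin \o (fun t => c x * K * f x 0 t) =
      (fun t => (c x * K)%:E * (f x 0 t)%:E)%E by apply/funext => t /=; rewrite EFinM.
  by apply: integrableZl; [exact: mD | exact: If].
apply: eq_bigr => x _; rewrite RintegralZl //.
  by rewrite [in RHS]big_ord_recl -mulrA; congr (_ * _); rewrite mulrC.
exact: mD.
Qed.

End BoxIntegrals.

(** * Integrals of Gegenbauer polynomials *)

Section ContinuousIntegrals.
Context {R : realType}.
Implicit Types (a b c : R) (f F g : R -> R).
Local Notation mu := (@lebesgue_measure R).

Lemma continuous_itv_integrable f a b : continuous f ->
  mu.-integrable `[a, b]%classic (EFin \o f).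
Proof.
move=> cf; apply: continuous_compact_integrable; first exact: segment_compact.
exact: continuous_subspaceT.
Qed.

Lemma is_derive_Rintegral f F a b : a < b -> continuous f ->
  (forall x : R, is_derive x 1 F (f x)) ->
  (\int[mu]_(x in `[a, b]) f x)%R = F b - F a.
Proof.
move=> ab cf dF; rewrite /Rintegral (@continuous_FTC2 _ f F) //.
- exact: continuous_subspaceT.
- have cF : continuous F.
    move=> x; apply/differentiable_continuous/derivable1_diffP.
    exact: (@ex_derive _ _ _ _ _ _ _ (dF x)).
  split.
  + by move=> x _; exact: (@ex_derive _ _ _ _ _ _ _ (dF x)).
  + exact/cvg_at_right_filter/cF.
  + exact/cvg_at_left_filter/cF.
- by move=> x _; rewrite derive1E (@derive_val _ _ _ _ _ _ _ (dF x)).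
Qed.

Lemma Rintegral_linear f g a b c c' : continuous f -> continuous g ->
  (\int[mu]_(x in `[a, b]) (c * f x + c' * g x))%R =
  c * (\int[mu]_(x in `[a, b]) f x)%R + c' * (\int[mu]_(x in `[a, b]) g x)%R.
Proof.
move=> cf cg.
have cM c0 f0 : continuous f0 -> continuous (fun x => c0 * f0 x).
  by move=> h x; apply: cvgM; [exact: cvg_cst | exact: h].
rewrite RintegralD ?RintegralZl //;
  by apply: continuous_itv_integrable => //; apply: cM.
Qed.

End ContinuousIntegrals.

Section GegenbauerIntegrals.
Context {R : realType}.
Implicit Types (f g h : {poly R}) (m n l : nat) (lam : R).
Local Notation mu := (@lebesgue_measure R).

(** With x = cos t, the integral of f(x) (1 - x^2)^((n-1)/2) over [-1, 1]; for n = 2 lam this is the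
    Gegenbauer weight. *)
Definition sin_int n f : R :=
  (\int[mu]_(t in `[0%R, pi]) (f.[cos t] * sin t ^+ n))%R.

Lemma continuous_sin_int n f : continuous (fun t : R => f.[cos t] * sin t ^+ n).
Proof.
move=> t; apply: cvgM.
  by apply: (@continuous_comp _ _ _ cos (horner f)); [exact: continuous_cos
    | exact: continuous_horner].
apply: (@continuous_comp _ _ _ sin (fun x => x ^+ n)); first exact: continuous_sin.
exact: exprn_continuous.
Qed.

Lemma sin_int_is_linear n : linear_for *%R (sin_int n).
Proof.
move=> c f g; rewrite /sin_int -[X in _ = _ + X]mul1r -Rintegral_linear; first last.
- exact: continuous_sin_int.
- exact: continuous_sin_int.
apply: eq_Rintegral => t _; rewrite hornerD hornerZ; ring.
Qed.

HB.instance Definition _ n :=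
  GRing.isLinear.Build R {poly R} R _ (sin_int n) (sin_int_is_linear n).

Lemma sin_int_addn2 n f : sin_int n.+2 f = sin_int n ((1 - 'X ^+ 2) * f).
Proof.
apply: eq_Rintegral => t _.
rewrite hornerM hornerD hornerN hornerXn hornerC -sin2cos2 -addn2 exprD; ring.
Qed.

(** The integrand is the derivative of - h(cos t) sin^(n+1) t, which vanishes at 0 and pi. *)
Lemma sin_int_div n h :
  sin_int n ((1 - 'X ^+ 2) * h^`() - (n.+1)%:R *: ('X * h)) = 0.
Proof.
pose F (t : R) : R := - (h.[cos t] * sin t ^+ n.+1).
have dF (t : R) : is_derive t 1 F
    (((1 - 'X ^+ 2) * h^`() - (n.+1)%:R *: ('X * h)).[cos t] * sin t ^+ n).
  have dh : is_derive t 1 (fun t => h.[cos t]) (h^`().[cos t] * - sin t).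
    exact: is_derive1_comp (is_derive_poly h (cos t)) (is_derive_cos t).
  have dS : is_derive t 1 (fun t : R => sin t ^+ n.+1)
      (n.+1%:R * sin t ^+ n * cos t).
    have -> : (fun t : R => sin t ^+ n.+1) = (@sin R) ^+ n.+1.
      by apply/funext => x; rewrite exprfctE.
    exact: is_deriveX.
  apply: (is_derive_eq (is_deriveN (is_deriveM dh dS))).
  rewrite hornerD hornerN hornerZ !hornerM hornerD hornerN hornerXn hornerC hornerX.
  rewrite -sin2cos2 /GRing.scale /= exprS; ring.
rewrite /sin_int (is_derive_Rintegral _ _ dF); first last.
- exact: continuous_sin_int.
- exact: pi_gt0.
by rewrite /F sinpi sin0 !expr0n /= !mulr0 subrr.
Qed.

(** The Wallis recursion, from the previous identity with h = X. *)
Lemma sin_int1S n : n.+2%:R * sin_int n.+2 1 = n.+1%:R * sin_int n 1.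
Proof.
rewrite sin_int_addn2 mulr1 linearB /=.
have := sin_int_div n 'X; rewrite derivX mulr1 linearB linearZ /= linearB /=.
have E : n.+2%:R = n.+1%:R + 1 :> R by rewrite natr1.
rewrite -expr2 E => h; lra.
Qed.

Lemma sin_int_pos n : 0 < sin_int n 1.
Proof.
have [k] := ubnP n; elim: k n => // k IH [|[|n]] nk.
- have dF (t : R) : is_derive t 1 id ((1 : {poly R}).[cos t] * sin t ^+ 0).
    by rewrite hornerC mulr1; exact: is_derive_id.
  rewrite /sin_int (is_derive_Rintegral (pi_gt0 _) (@continuous_sin_int _ _) dF).
  by rewrite subr0 pi_gt0.
- have dF (t : R) : is_derive t 1 (fun t : R => - cos t)
      ((1 : {poly R}).[cos t] * sin t ^+ 1).
    by apply: is_derive_eq; rewrite hornerC; ring.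
  rewrite /sin_int (is_derive_Rintegral (pi_gt0 _) (@continuous_sin_int _ _) dF).
  by rewrite cospi cos0; lra.
- have h : 0 < n.+2%:R * sin_int n.+2 1.
    rewrite sin_int1S; apply: mulr_gt0 => //; apply: IH; lia.
  by rewrite pmulr_rgt0 in h.
Qed.

Lemma sin_intZ n (c : R) f : sin_int n (c *: f) = c * sin_int n f.
Proof. exact: linearZ. Qed.

(** The Gegenbauer operator, w^(-1) ((1 - x^2) w g')' for the weight w = (1 - x^2)^((n-1)/2). *)
Definition jacobi_op n g : {poly R} :=
  (1 - 'X ^+ 2) * g^`()^`() - (n.+1)%:R *: ('X * g^`()).

(** Integration by parts, as the case h = f g' of [sin_int_div]. The right side is symmetric in f
    and g. *)
Lemma sin_int_jacobi n f g :
  sin_int n (f * jacobi_op n g) = - sin_int n.+2 (f^`() * g^`()).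
Proof.
apply/eqP; rewrite -subr_eq0 opprK sin_int_addn2 -linearD /=.
rewrite -(sin_int_div n (f * g^`())) /jacobi_op derivM; apply/eqP.
congr sin_int; rewrite -!mul_polyC; ring.
Qed.

End GegenbauerIntegrals.

(** * Differential equation, orthogonality and norms of Gegenbauer polynomials *)

Section GegenbauerPolynomials.
Context {R : realType}.
Implicit Types (m n l : nat) (lam : R).

Definition gegenbauer_poly lam m : {poly R} :=
  \sum_(l < (m./2).+1) gegenbauer_coef lam m l *: 'X ^+ (m - l.*2).

Lemma horner_gegenbauer lam m (t : R) :
  (gegenbauer_poly lam m).[t] = gegenbauer lam m t.
Proof.
rewrite gegenbauerE /gegenbauer_poly horner_sum.
by apply: eq_bigr => l _; rewrite hornerZ hornerXn.
Qed.

Lemma jacobi_op_is_linear n : linear (@jacobi_op R n).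
Proof.
by move=> c f g; rewrite /jacobi_op !linearP /= -!mul_polyC; ring.
Qed.

HB.instance Definition _ n :=
  GRing.isLinear.Build R {poly R} {poly R} _ (@jacobi_op R n) (jacobi_op_is_linear n).

Lemma jacobi_opXn n a : jacobi_op n ('X ^+ a) =
  (a%:R * (a%:R - 1)) *: 'X ^+ a.-2 - (a%:R * (a%:R + n%:R)) *: 'X ^+ a :> {poly R}.
Proof.
rewrite /jacobi_op; case: a => [|[|a]].
- by rewrite expr0 -(polyC1 R) !derivC polyC1 !mul0r !scale0r !mulr0 scaler0.
- rewrite expr1 derivX -(polyC1 R) derivC polyC1 subrr !mulr0 scale0r mulr1 mul1r.
  by rewrite -[n.+1]add1n natrD.
have E k : k.+1%:R = k%:R + 1 :> {poly R} by rewrite natr1.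
have E1 k : k.+1%:R = k%:R + 1 :> R by rewrite natr1.
rewrite !derivXn derivMn derivXn /= -(mulr_natr 'X^a a.+1).
rewrite -(mulr_natr ('X^a * _) a.+2) -(mulr_natr 'X^(a.+1) a.+2) -!mul_polyC !E1 !E.
rewrite !(polyCM, polyCD, polyCN, polyC_natr, polyC1).
move: (n%:R) (a%:R) => x y; rewrite !exprS; ring.
Qed.

Lemma gegenbauer_ode lam m n : 0 < lam -> 2 * lam = n%:R ->
  jacobi_op n (gegenbauer_poly lam m) =
  - (m%:R * (m%:R + n%:R)) *: gegenbauer_poly lam m.
Proof.
move=> lam0 lamn; apply/eqP; rewrite -subr_eq0 -scaleNr opprK; apply/eqP.
(* For a = m - 2l, the coefficient of X^a comes from m (m + n) - a (a + n) = 2l (2 (m - l) + 2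
   lam). *)
have -> : jacobi_op n (gegenbauer_poly lam m)
    + (m%:R * (m%:R + n%:R)) *: gegenbauer_poly lam m =
  \sum_(l < (m./2).+1)
   ((2 * l%:R * (2 * (m%:R - l%:R) + 2 * lam) * gegenbauer_coef lam m l)
      *: 'X ^+ (m - l.*2) +
    ((m%:R - l.*2%:R) * (m%:R - l.*2%:R - 1) * gegenbauer_coef lam m l)
      *: 'X ^+ (m - l.*2).-2).
  rewrite /gegenbauer_poly linear_sum /= scaler_sumr -big_split /=.
  apply: eq_bigr => l _; rewrite linearZ /= jacobi_opXn.
  have lm : (l.*2 <= m)%N by have := ltn_ord l; lia.
  have E : m%:R - l.*2%:R = (m - l.*2)%:R :> R by rewrite natrB.
  have E' : l%:R = (m%:R - (m - l.*2)%:R) / 2 :> R.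
    by rewrite -E -muln2 natrM; field.
  rewrite scalerBr !scalerA -addrA addrC [- _ + _]addrC -scalerBl.
  rewrite E {}E' lamn; congr (_ *: _ + _ *: _); by field.
pose A (l : nat) : {poly R} := (2 * l%:R * (2 * (m%:R - l%:R) + 2 * lam) *
  gegenbauer_coef lam m l) *: 'X ^+ (m - l.*2).
pose B (l : nat) : {poly R} := ((m%:R - l.*2%:R) * (m%:R - l.*2%:R - 1) *
  gegenbauer_coef lam m l) *: 'X ^+ (m - l.*2).-2.
rewrite (eq_bigr (fun l : 'I__ => A l + B l)) // big_split /=.
rewrite big_ord_recl big_ord_recr /=.
have -> : A 0 = 0 by rewrite /A mulr0 !mul0r scale0r.
have -> : B m./2 = 0.
  rewrite /B (_ : m%:R - (m./2).*2%:R = (odd m)%:R :> R); last first.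
    by rewrite -{1}(odd_double_half m) natrD addrK.
  by case: odd; rewrite ?subrr ?mulr0 ?mul0r scale0r.
rewrite add0r addr0 -big_split /= big1 // => l _.
rewrite /A /B /bump /= add1n.
rewrite (_ : (m - (l.*2).+2 = (m - l.*2).-2)%N); last by lia.
rewrite -scalerDl gegenbauer_coefS ?scale0r //.
by have := ltn_ord l; lia.
Qed.

(** Both sides are the symbol of length k + 1, split at its first or at its last factor. *)
Lemma pochhammer_mulS (a : R) k :
  a * pochhammer (a + 1) k = pochhammer a k * (a + k%:R).
Proof.
rewrite -pochhammerS /pochhammer big_ord_recl addr0; congr (_ * _).
by apply: eq_bigr => i _; rewrite -natr1 -addrA [1 + _]addrC.
Qed.

Lemma gegenbauer_coef_deriv lam m l : 0 < lam -> (l.*2 <= m)%N ->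
  (m.+1 - l.*2)%:R * gegenbauer_coef lam m.+1 l =
  2 * lam * gegenbauer_coef (lam + 1) m l.
Proof.
move=> lam0 lm; rewrite /gegenbauer_coef.
have E1 : m.+1%:R = m%:R + 1 :> R by rewrite natr1.
have E2 : 1 - m%:R - (lam + 1) = 1 - m.+1%:R - lam by rewrite E1; ring.
have E3 : pochhammer lam m.+1 = lam * pochhammer (lam + 1) m.
  by rewrite pochhammer_mulS pochhammerS.
have p0 : pochhammer (1 - m.+1%:R - lam) l != 0.
  by apply: gegenbauer_pochhammer_neq0 => //; lia.
have f0 : l`!%:R != 0 :> R by rewrite pnatr_eq0 -lt0n fact_gt0.
have f1 : m`!%:R != 0 :> R by rewrite pnatr_eq0 -lt0n fact_gt0.
have f2 : m.+1%:R != 0 :> R by rewrite pnatr_eq0.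
have E4 : (1 - m.+1%:R) / 2 = - (m%:R / 2) :> R by rewrite E1; field.
have E5 : (m.+1 - l.*2)%:R * pochhammer (- (m.+1%:R / 2)) l =
   m.+1%:R * pochhammer ((1 - m%:R) / 2) l :> R.
  have := pochhammer_mulS (- (m.+1%:R / 2)) l.
  have -> : - (m.+1%:R / 2) + 1 = (1 - m%:R) / 2 :> R by rewrite E1; field.
  have -> : - (m.+1%:R / 2) + l%:R = - ((m.+1 - l.*2)%:R / 2) :> R.
    by rewrite natrB ?leqW // -muln2 natrM; field.
  have aux (a b x y : R) : - (a / 2) * x = y * - (b / 2) -> b * y = a * x.
    move=> h; transitivity (- 2 * (y * - (b / 2))); first by field.
    by rewrite -h; field.
  exact: aux.
rewrite E2 E3 E4 factS natrM exprS.
set P := pochhammer (1 - m.+1%:R - lam) l in p0 *.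
transitivity (2 * lam * (pochhammer (lam + 1) m * 2 ^+ m / (m.+1%:R * m`!%:R)) *
  (((m.+1 - l.*2)%:R * pochhammer (- (m.+1%:R / 2)) l) * pochhammer (- (m%:R / 2)) l)
   / (l`!%:R * P)).
  by move: (m.+1%:R) f2 => M f2; field; rewrite f0 p0 f1 f2.
by rewrite E5; move: (m.+1%:R) f2 => M f2; field; rewrite f0 p0 f1 f2.
Qed.

Lemma deriv_gegenbauer_poly lam m : 0 < lam ->
  (gegenbauer_poly lam m.+1)^`() = (2 * lam) *: gegenbauer_poly (lam + 1) m.
Proof.
move=> lam0; rewrite /gegenbauer_poly linear_sum /= scaler_sumr.
transitivity (\sum_(l < (m./2).+1)
   (gegenbauer_coef lam m.+1 l *: 'X ^+ (m.+1 - l.*2))^`()).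
  (* For odd m the polynomial of degree m + 1 has one more term, a constant, which the derivative
     kills. *)
  rewrite /= uphalf_half; have [om|om] := boolP (odd m); last by rewrite add0n.
  rewrite add1n big_ord_recr /= (_ : (m.+1 - (m./2.+1).*2 = 0)%N); last by lia.
  by rewrite derivZ expr0 derivC scaler0 addr0.
apply: eq_bigr => l _; rewrite derivZ derivXn scalerA.
have lm : (l.*2 <= m)%N by have := ltn_ord l; lia.
rewrite -gegenbauer_coef_deriv // -scaler_nat scalerA mulrC.
by congr (_ *: 'X ^+ _); lia.
Qed.

(** The operator is symmetric for the weight, and the eigenvalues -m (m + n) and -m' (m' + n)
    differ. *)
Lemma gegenbauer_orthogonal lam m m' n : (0 < n)%N -> 2 * lam = n%:R ->
  m != m' ->
  sin_int n (gegenbauer_poly lam m * gegenbauer_poly lam m') = 0.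
Proof.
move=> n0 ln mm'.
have l0 : 0 < lam.
  have h : 0 < n%:R :> R by rewrite ltr0n.
  lra.
set f := gegenbauer_poly lam m; set g := gegenbauer_poly lam m'.
have h1 : sin_int n (f * jacobi_op n g) = sin_int n (g * jacobi_op n f).
  by rewrite !sin_int_jacobi mulrC.
move: h1; rewrite !(gegenbauer_ode _ l0 ln) -!scalerAr !sin_intZ [g * f]mulrC.
set I := sin_int n _ => h1; apply/eqP; move/eqP: h1.
rewrite -subr_eq0 -mulrBl mulf_eq0 => /orP[|//].
have -> : - (m'%:R * (m'%:R + n%:R)) - - (m%:R * (m%:R + n%:R)) =
  (m%:R - m'%:R) * (m%:R + m'%:R + n%:R) :> R by ring.
rewrite mulf_eq0 subr_eq0 eqr_nat (negPf mm') -!natrD pnatr_eq0; lia.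
Qed.

(** Integration by parts with f = g = C_(m+1)^lam gives (m + 1) (m + 1 + n) a = 4 lam^2 b, where a
    is its squared norm and b that of C_m^(lam+1) for n + 2; b is known by induction. *)
Lemma gegenbauer_norm lam m n : (0 < n)%N -> 2 * lam = n%:R ->
  sin_int n (gegenbauer_poly lam m ^+ 2) * (m`!%:R * (m%:R + lam)) =
  lam * pochhammer (2 * lam) m * sin_int n 1.
Proof.
elim: m lam n => [|m IH] lam n n0 ln.
  rewrite /gegenbauer_poly big_ord1 /gegenbauer_coef !pochhammer0 fact0 expr0.
  rewrite /= expr0 !(mulr1, mul1r, invr1, scale1r, add0r) expr1n.
  exact: mulrC.
have l0 : 0 < lam.
  have h : 0 < n%:R :> R by rewrite ltr0n.
  lra.
have {}IH := IH (lam + 1) n.+2 isT.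
have E : 2 * (lam + 1) = n.+2%:R :> R.
  have -> : n.+2%:R = n%:R + 1 + 1 :> R by rewrite !natr1.
  by rewrite -ln; ring.
have {}IH := IH E.
have J := sin_int_jacobi n (gegenbauer_poly lam m.+1) (gegenbauer_poly lam m.+1).
move: J; rewrite (gegenbauer_ode _ l0 ln) deriv_gegenbauer_poly //.
rewrite -scalerAr -scalerAl -scalerAr !sin_intZ -!expr2.
set a := sin_int n _; set b := sin_int n.+2 _ in IH * => J.
have W := @sin_int1S R n.
have P1 := pochhammer_mulS (2 * lam) m.
have P2 := pochhammer_mulS (2 * lam + 1) m.
set Q := pochhammer (2 * lam + 1) m in P1 P2.
have P3 : pochhammer (2 * lam) m.+1 = 2 * lam * Q by rewrite pochhammerS.
have e2 : 2 * lam + 1 + 1 = 2 * (lam + 1) by ring.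
rewrite e2 in P2; set T := pochhammer (2 * (lam + 1)) m in P2 IH.
have E1 : m.+1%:R = m%:R + 1 :> R by rewrite natr1.
have E2 : n.+2%:R = n%:R + 1 + 1 :> R by rewrite !natr1.
have E3 : n.+1%:R = n%:R + 1 :> R by rewrite natr1.
rewrite P3 factS natrM; rewrite E1 -ln in J; rewrite E2 E3 -ln in W.
rewrite E1; set k := m%:R in J IH P1 P2 E1 *.
have k0 : 0 <= k by rewrite ler0n.
(* The first factor comes from the eigenvalue and the second, n + 2, from the Wallis recursion;
   multiplying by both avoids division. *)
have c0 : (k + 1 + 2 * lam) * (2 * lam + 1 + 1) != 0.
  by apply/eqP => /eqP; rewrite mulf_eq0 => /orP[] /eqP; lra.
apply: (mulIf c0).
transitivity ((k + 1) * (k + 1 + 2 * lam) * a * (m`!%:R * (k + 1 + lam))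
  * (2 * lam + 1 + 1)); first by ring.
have -> : (k + 1) * (k + 1 + 2 * lam) * a = 2 * lam * (2 * lam * b) by lra.
transitivity (4 * lam ^+ 2 * (b * (m`!%:R * (k + (lam + 1)))) * (2 * lam + 1 + 1)).
  by ring.
rewrite IH.
transitivity (4 * lam ^+ 2 * (lam + 1) * T * ((2 * lam + 1 + 1) * sin_int n.+2 1)).
  by ring.
rewrite W.
transitivity (4 * lam ^+ 2 * (lam + 1) * ((2 * lam + 1) * T) * sin_int n 1).
  by ring.
rewrite P2; ring.
Qed.

End GegenbauerPolynomials.

(** * Orthogonality of the trigonometric functions *)

Section TrigonometricIntegrals.
Context {R : realType}.
Implicit Types (a t : R) (k l : nat).
Local Notation mu := (@lebesgue_measure R).
Local Notation circ_int f := (\int[mu]_(t in `[0%R, (2 * pi)%R]) f t)%R.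

Lemma two_pi_gt0 : 0 < 2 * pi :> R.
Proof. by rewrite mulr_gt0 // pi_gt0. Qed.

Lemma cos_nat2pi k : cos (k%:R * (2 * pi)) = 1 :> R /\ sin (k%:R * (2 * pi)) = 0 :> R.
Proof.
elim: k => [|k [IH1 IH2]]; first by rewrite mul0r cos0 sin0.
have E : k.+1%:R = k%:R + 1 :> R by rewrite natr1.
rewrite E mulrDl mul1r cosD sinD IH1 IH2 mulr_natl cos2pi sin2pi; split; ring.
Qed.

Lemma is_derive_cosM a t : is_derive t 1 (fun t => cos (a * t)) (- (a * sin (a * t))).
Proof.
have h : is_derive t 1 (fun t : R => a * t) a.
  by apply: is_derive_eq; rewrite /GRing.scale /= mulr1.
apply: (is_derive_eq (is_derive1_comp (is_derive_cos (a * t)) h)).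
by rewrite mulNr mulrC.
Qed.

Lemma is_derive_sinM a t : is_derive t 1 (fun t => sin (a * t)) (a * cos (a * t)).
Proof.
have h : is_derive t 1 (fun t : R => a * t) a.
  by apply: is_derive_eq; rewrite /GRing.scale /= mulr1.
apply: (is_derive_eq (is_derive1_comp (is_derive_sin (a * t)) h)).
exact: mulrC.
Qed.

Lemma continuous_cosM a : continuous (fun t => cos (a * t)).
Proof.
move=> t; apply/differentiable_continuous/derivable1_diffP.
exact: (@ex_derive _ _ _ _ _ _ _ (is_derive_cosM a t)).
Qed.

Lemma continuous_sinM a : continuous (fun t => sin (a * t)).
Proof.
move=> t; apply/differentiable_continuous/derivable1_diffP.
exact: (@ex_derive _ _ _ _ _ _ _ (is_derive_sinM a t)).
Qed.

Lemma circ_int_cos a : a != 0 -> sin (a * (2 * pi)) = 0 ->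
  circ_int (fun t => cos (a * t)) = 0.
Proof.
move=> a0 ha.
have dF (t : R) : is_derive t 1 (fun t => a^-1 * sin (a * t)) (cos (a * t)).
  apply: (is_derive_eq (is_deriveZ a^-1 (is_derive_sinM a t))).
  by rewrite /GRing.scale /= mulKf.
rewrite (is_derive_Rintegral two_pi_gt0 (@continuous_cosM a) dF).
by rewrite ha mulr0 [a * 0]mulr0 sin0 mulr0 subr0.
Qed.

Lemma circ_int_sin a : cos (a * (2 * pi)) = 1 ->
  circ_int (fun t => sin (a * t)) = 0.
Proof.
have [->|a0] := eqVneq a 0.
  move=> _; rewrite [LHS](_ : _ = circ_int (fun=> (0 : R))); last first.
    by apply: eq_Rintegral => t _; rewrite mul0r sin0.
  by rewrite Rintegral_cst //= mul0r.
move=> ha.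
have dF (t : R) : is_derive t 1 (fun t => - a^-1 * cos (a * t)) (sin (a * t)).
  apply: (is_derive_eq (is_deriveZ (- a^-1) (is_derive_cosM a t))).
  by rewrite /GRing.scale /= mulrNN mulKf.
rewrite (is_derive_Rintegral two_pi_gt0 (@continuous_sinM a) dF).
by rewrite ha mulr0 cos0 subrr.
Qed.

Lemma circ_int1 : circ_int (fun t => cos (0 * t)) = 2 * pi.
Proof.
have dF (t : R) : is_derive t 1 id (cos (0 * t)).
  by rewrite mul0r cos0; exact: is_derive_id.
by rewrite (is_derive_Rintegral two_pi_gt0 (@continuous_cosM 0) dF) subr0.
Qed.

Lemma circ_int_cos_nat k l : circ_int (fun t => cos ((k%:R - l%:R) * t)) =
  if k == l then 2 * pi else 0.
Proof.
have [->|kl] := eqVneq k l; first by rewrite subrr; exact: circ_int1.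
have [ck sk] := cos_nat2pi k; have [cl sl] := cos_nat2pi l.
rewrite circ_int_cos // ?subr_eq0 ?eqr_nat // mulrBl sinB ck sk cl sl; ring.
Qed.

Lemma circ_int_cos_natD k l : circ_int (fun t => cos ((k%:R + l%:R) * t)) =
  if k + l == 0%N then 2 * pi else 0.
Proof.
have := circ_int_cos_nat (k + l) 0; rewrite -natrD subr0 => <- //.
Qed.

Lemma circ_int_coscos k l :
  circ_int (fun t => cos (k%:R * t) * cos (l%:R * t)) =
  if k == l then (if k == 0%N then 2 * pi else pi) else 0.
Proof.
transitivity (circ_int (fun t => 2^-1 * cos ((k%:R - l%:R) * t)
                              + 2^-1 * cos ((k%:R + l%:R) * t))).
  by apply: eq_Rintegral => t _; rewrite mulrBl mulrDl cosB cosD; field.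
rewrite Rintegral_linear; [|exact: continuous_cosM..].
rewrite circ_int_cos_nat circ_int_cos_natD addn_eq0.
case: (eqVneq k l) => [->|kl]; first by rewrite andbb; case: ifP => _; field.
by case: ifP => [/andP[/eqP k0 /eqP l0]|]; [rewrite k0 l0 in kl | rewrite !mulr0 addr0].
Qed.

Lemma circ_int_sinsin k l :
  circ_int (fun t => sin (k.+1%:R * t) * sin (l.+1%:R * t)) =
  if k == l then pi else 0.
Proof.
transitivity (circ_int (fun t => 2^-1 * cos ((k.+1%:R - l.+1%:R) * t)
                              + - 2^-1 * cos ((k.+1%:R + l.+1%:R) * t))).
  by apply: eq_Rintegral => t _; rewrite mulrBl mulrDl cosB cosD; field.
rewrite Rintegral_linear; [|exact: continuous_cosM..].
rewrite circ_int_cos_nat circ_int_cos_natD eqSS /= mulr0 addr0.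
by case: eqP => _; [field | rewrite mulr0].
Qed.

Lemma circ_int_cossin k l :
  circ_int (fun t => cos (k%:R * t) * sin (l%:R * t)) = 0.
Proof.
transitivity (circ_int (fun t => 2^-1 * sin ((l%:R - k%:R) * t)
                              + 2^-1 * sin ((l%:R + k%:R) * t))).
  by apply: eq_Rintegral => t _; rewrite mulrBl mulrDl sinB sinD; field.
rewrite Rintegral_linear; [|exact: continuous_sinM..].
have [ck sk] := cos_nat2pi k; have [cl sl] := cos_nat2pi l.
rewrite !circ_int_sin ?mulr0 ?addr0 //.
  by rewrite mulrDl cosD ck sk cl sl; ring.
by rewrite mulrBl cosB ck sk cl sl; ring.
Qed.

(** [bfac] is the inverse of the mean square: 1 for the constant function, 2 for every other cosine
    and for the sines, whose frequencies are positive. *)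
Lemma circ_int_gfun d (alpha beta : d.-tuple nat) :
  (idx alpha d <= 1)%N -> (idx beta d <= 1)%N ->
  circ_int (fun t => gfun alpha t * gfun beta t) =
  if (idx alpha d.-1 == idx beta d.-1) && (idx alpha d == idx beta d)
  then 2 * pi / bfac alpha else 0.
Proof.
move=> ha hb; rewrite /gfun /bfac.
case: (idx alpha d) ha => [|[|//]] _; case: (idx beta d) hb => [|[|//]] _ /=;
  rewrite ?andbT ?andbF ?addn0 ?addn1.
- rewrite circ_int_coscos; case: eqP => // _; case: (idx alpha _) => [|m] /=; by field.
- exact: circ_int_cossin.
- under eq_Rintegral do rewrite mulrC; exact: circ_int_cossin.
- by rewrite circ_int_sinsin; case: eqP => // _; field.
Qed.

Lemma continuous_gfun d (alpha : d.-tuple nat) : continuous (@gfun R d alpha).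
Proof.
rewrite /gfun; case: eqP => _; first exact: continuous_cosM.
exact: continuous_sinM.
Qed.

End TrigonometricIntegrals.

(** * Orthonormality *)

Section SphereIntegrals.
Context {R : realType} {d : nat} (hd : (2 < d)%N).
Implicit Types (alpha beta : d.-tuple nat) (i k : nat) (x : 'rV[R]_d).
Local Notation mu := (@lebesgue_measure R).

(** As a polynomial in x, the value is the same for all polar coordinates of x. *)
Lemma Y_polar_coordinates alpha x p : (idx alpha d <= 1)%N ->
  polar_coordinates x p ->
  Y_polar alpha p.1 p.2 = meval (fun i : 'I_d => x 0 i) (solid_harm hd alpha).
Proof. by move=> ad [_ _ <-]; rewrite -(meval_solid_harm hd). Qed.

Lemma Y_meval alpha x : (idx alpha d <= 1)%N ->
  Y alpha x = meval (fun i : 'I_d => x 0 i) (solid_harm hd alpha).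
Proof.
(* The default (0, 0) of [xget] is never taken, since polar coordinates exist. *)
move=> ad; apply: Y_polar_coordinates => //; apply: xgetPex.
by apply: polar_coordinates_exist; exact: ltnW.
Qed.

Lemma Y_polarP alpha (theta : 'rV[R]_d.-1) : (idx alpha d <= 1)%N ->
  Y alpha (polar 1 theta) = Y_polar alpha 1 theta.
Proof. by move=> ad; rewrite Y_meval // meval_solid_harm. Qed.

Definition gegen alpha k : {poly R} :=
  gegenbauer_poly (lambda alpha (d - k)) (idx alpha (d - k)).

(* The factor depending on the angle theta_(i+1) of the product of two
   harmonics and the area density. *)
Definition angular alpha beta i (t : R) : R :=
  if i == 0%N then gfun alpha t * gfun beta t
  else (gegen alpha i.+1 * gegen beta i.+1).[cos t] *
       sin t ^+ (sdeg alpha i.+1 + sdeg beta i.+1 + i).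

Definition angular_int alpha beta i : R :=
  (\int[mu]_(t in angle_range i) angular alpha beta i t)%R.

Lemma measurable_angle_range i : measurable (@angle_range R i).
Proof. by rewrite /angle_range; case: ifP => _; exact: measurable_itv. Qed.

Lemma integrable_angle_range i (f : R -> R) : continuous f ->
  mu.-integrable (angle_range i) (EFin \o f).
Proof. by rewrite /angle_range; case: ifP => _; exact: continuous_itv_integrable. Qed.

Lemma continuous_angular alpha beta i : continuous (angular alpha beta i).
Proof.
rewrite /angular; case: eqP => _; last exact: continuous_sin_int.
by move=> t; apply: cvgM; exact: continuous_gfun.
Qed.

Lemma prod_angle (F : nat -> R -> R) (u : 'rV[R]_d.-1) :
  \prod_(i < d.-1) F i (u 0 i) =
  F 0%N (angle u 1) * \prod_(2 <= k < d) F k.-1 (angle u k).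
Proof.
rewrite (eq_bigr (fun i : 'I_d.-1 => F i (angle u i.+1))); last first.
  by move=> i _; rewrite angleS.
rewrite -(big_mkord xpredT (fun i => F i (angle u i.+1))) big_ltn; last by lia.
by rewrite [in RHS]big_add1.
Qed.

Lemma sphere_density alpha beta (u : 'rV[R]_d.-1) : (idx alpha d <= 1)%N ->
  (idx beta d <= 1)%N -> (forall i : 'I_d.-1, angle_range i (u 0 i)) ->
  Y alpha (polar 1 u) * Y beta (polar 1 u) *
  Num.sqrt (\det (jacobian (polar 1) u *m (jacobian (polar 1) u)^T)) =
  hfac alpha * hfac beta * \prod_(i < d.-1) angular alpha beta i (u 0 i).
Proof.
move=> ad bd hu; rewrite sqrt_det_polar; first last.
- move=> j j0; have := hu j; rewrite /angle_range (_ : (j == 0%N :> nat) = false).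
    by rewrite /= in_itv.
  by lia.
- exact: ltnW.
rewrite (prod_angle (fun i t => sin t ^+ i)) expr0 mul1r.
rewrite prod_angle /angular /= !Y_polarP // !(Y_polarE hd) !expr1n !mulr1.
rewrite [X in _ = _ * (_ * X)](_ : _ =
  (\prod_(2 <= i < d) (sin (angle u i) ^+ sdeg alpha i *
    gegenbauer (lambda alpha (d - i)) (idx alpha (d - i)) (cos (angle u i)))) *
  (\prod_(2 <= i < d) (sin (angle u i) ^+ sdeg beta i *
    gegenbauer (lambda beta (d - i)) (idx beta (d - i)) (cos (angle u i)))) *
  \prod_(2 <= k < d) sin (angle u k) ^+ k.-1); first ring.
rewrite -!big_split /= !big_nat; apply: eq_bigr => -[|[|k]] //= _.
rewrite hornerM !horner_gegenbauer !exprD; ring.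
Qed.

(** Linearity in the first argument, restricted to combinations of the [Y], where integrability is
    at hand; it serves for linear independence. *)
Lemma sphere_integral_sum (T : Type) (s : seq T) (a : T -> d.-tuple nat)
    (c : T -> R) beta : (forall z, idx (a z) d <= 1)%N -> (idx beta d <= 1)%N ->
  sphere_integral (fun x => (\sum_(z <- s) c z * Y (a z) x) * Y beta x) =
  \sum_(z <- s) c z * (hfac (a z) * hfac beta *
    \prod_(i < d.-1) angular_int (a z) beta i).
Proof.
move=> ad bd; rewrite /sphere_integral /surface_integral.
transitivity (box_integral angle_range (fun u : 'rV[R]_d.-1 =>
  \sum_(z <- s) (c z * (hfac (a z) * hfac beta)) *
    \prod_(i < d.-1) angular (a z) beta i (u 0 i))).
  apply: eq_box_integral => u hu; rewrite !mulr_suml; apply: eq_bigr => z _.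
  by have E := sphere_density (ad z) bd hu; rewrite -[RHS]mulrA -E; ring.
rewrite (@box_integral_sum_prod R T s d.-1 angle_range
  (fun z => c z * (hfac (a z) * hfac beta)) (fun z => angular (a z) beta)).
- by apply: eq_bigr => z _; rewrite [RHS]mulrA.
- exact: measurable_angle_range.
- by move=> z i; apply/integrable_angle_range/continuous_angular.
Qed.

Lemma sphere_integral_Y alpha beta : (idx alpha d <= 1)%N -> (idx beta d <= 1)%N ->
  sphere_integral (fun x => Y alpha x * Y beta x) =
  hfac alpha * hfac beta * \prod_(i < d.-1) angular_int alpha beta i.
Proof.
move=> ad bd.
have := @sphere_integral_sum unit [:: tt] (fun=> alpha) (fun=> 1) beta (fun=> ad) bd.
rewrite big_seq1 mul1r => <-; congr sphere_integral.
by apply/funext => x; rewrite big_seq1 mul1r.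
Qed.

Lemma prod_split0 (F : nat -> R) :
  \prod_(i < d.-1) F i = F 0%N * \prod_(1 <= i < d.-1) F i.
Proof. by rewrite -(big_mkord xpredT F) big_ltn //; lia. Qed.

Lemma sphere_areaE :
  sphere_area d = 2 * pi * \prod_(1 <= i < d.-1) sin_int i (1 : {poly R}).
Proof.
rewrite /sphere_area /sphere_integral /surface_integral.
transitivity (box_integral angle_range (fun u : 'rV[R]_d.-1 =>
  \sum_(z <- [:: tt]) 1 * \prod_(i < d.-1) ((1 : {poly R}).[cos (u 0 i)] * sin (u 0 i) ^+ i))).
  apply: eq_box_integral => u hu; rewrite big_seq1 !mul1r sqrt_det_polar.
  - by apply: eq_bigr => i _; rewrite hornerC mul1r.
  - exact: ltnW.
  - move=> j j0; have := hu j; rewrite /angle_range (_ : (j == 0%N :> nat) = false).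
      by rewrite /= in_itv.
    by lia.
rewrite (@box_integral_sum_prod R unit [:: tt] d.-1 angle_range (fun=> 1)
  (fun _ i t => (1 : {poly R}).[cos t] * sin t ^+ i)); first last.
- by move=> z i; apply/integrable_angle_range/continuous_sin_int.
- exact: measurable_angle_range.
rewrite big_seq1 mul1r (prod_split0 (fun i =>
  (\int[mu]_(t in angle_range i) ((1 : {poly R}).[cos t] * sin t ^+ i))%R)); congr (_ * _).
  rewrite /angle_range /=; under eq_Rintegral do rewrite hornerC mulr1.
  have := @circ_int1 R; under eq_Rintegral do rewrite mul0r cos0.
  by move=> ->.
by rewrite !big_nat; apply: eq_bigr => -[|i].
Qed.

Lemma sphere_area_gt0 : 0 < sphere_area d :> R.
Proof.
rewrite sphere_areaE mulr_gt0 ?two_pi_gt0 //.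
by apply: prodr_gt0 => i _; exact: sin_int_pos.
Qed.

(** The sine exponent in [angular alpha alpha i] is twice the Gegenbauer parameter, so the weight is
    the right one. *)
Lemma two_lambda alpha i : (i.+1 < d)%N ->
  2 * lambda alpha (d - i.+1) = (sdeg alpha i.+1 + sdeg alpha i.+1 + i)%:R :> R.
Proof.
move=> id.
have := @lambda_sdeg R d alpha (Ordinal id) => /= ->.
have E : i.+1%:R = i%:R + 1 :> R by rewrite natr1.
by rewrite !natrD E; field.
Qed.

Lemma angular_int0 alpha beta : (idx alpha d <= 1)%N -> (idx beta d <= 1)%N ->
  angular_int alpha beta 0 =
  if (idx alpha d.-1 == idx beta d.-1) && (idx alpha d == idx beta d)
  then 2 * pi / bfac alpha else 0.
Proof. by move=> ad bd; rewrite -circ_int_gfun. Qed.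

Lemma angular_intE alpha beta i : (0 < i)%N -> angular_int alpha beta i =
  sin_int (sdeg alpha i.+1 + sdeg beta i.+1 + i) (gegen alpha i.+1 * gegen beta i.+1).
Proof. by case: i. Qed.

Lemma angular_int_orthogonal alpha beta i : (0 < i < d.-1)%N ->
  sdeg alpha i.+1 = sdeg beta i.+1 ->
  idx alpha (d - i.+1) != idx beta (d - i.+1) -> angular_int alpha beta i = 0.
Proof.
move=> /andP[i0 id] e ne; rewrite angular_intE // /gegen.
have i1d : (i.+1 < d)%N by lia.
have eqlam : lambda alpha (d - i.+1) = lambda beta (d - i.+1) :> R.
  have := @lambda_sdeg R d alpha (Ordinal i1d); rewrite /= => ->.
  by have := @lambda_sdeg R d beta (Ordinal i1d); rewrite /= => ->; rewrite e.
rewrite eqlam; apply: gegenbauer_orthogonal => //; first by lia.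
by rewrite -eqlam two_lambda ?e //; lia.
Qed.

(** If no factor vanishes, the integral in theta_1 forces the last two indices to agree. Then the
    tail degrees, hence parameter and weight, agree at the next angle, which forces the next index,
    and so on down to the first. *)
Lemma prod_angular_eq0 alpha beta : (idx alpha d <= 1)%N -> (idx beta d <= 1)%N ->
  alpha != beta -> \prod_(i < d.-1) angular_int alpha beta i = 0.
Proof.
move=> ad bd ne; apply/eqP/negPn/negP => /prodf_neq0 nz; case/negP: ne; apply/eqP.
have nz' i : (i < d.-1)%N -> angular_int alpha beta i != 0.
  by move=> id; exact: (nz (Ordinal id)).
have d0 : (0 < d.-1)%N by lia.
have /andP[/eqP e1 /eqP e2] : (idx alpha d.-1 == idx beta d.-1) &&
    (idx alpha d == idx beta d).
  by have := nz' _ d0; rewrite angular_int0 //; case: ifP => //; rewrite eqxx.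
have H k : (2 <= k <= d)%N -> sdeg alpha k = sdeg beta k /\
    (forall i, (2 <= i < k)%N -> idx alpha (d - i) = idx beta (d - i)).
  elim: k => // k IH /andP[k1 kd]; have [->|k2] := eqVneq k 1%N.
    split; last by move=> i; lia.
    by rewrite !(sdeg2 hd) e1 e2.
  have [|h1 h2] := IH; first by lia.
  have h3 : idx alpha (d - k) = idx beta (d - k).
    apply/eqP/negPn/negP => ne.
    have /eqP := nz' k.-1 ltac:(lia); apply.
    by apply: angular_int_orthogonal; rewrite ?prednK //; lia.
  split; first by rewrite !sdegS // h1 h3.
  by move=> i /andP[i2]; rewrite ltnS leq_eqVlt => /predU1P[->//|ik]; apply: h2; lia.
have [|_ H2] := H d; first by lia.
apply: eq_from_tnth => i; rewrite !(tnth_nth 0%N).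
have Hj j : (1 <= j <= d)%N -> idx alpha j = idx beta j.
  move=> jd; have [->//|jd1] := eqVneq j d.
  have [->//|jd2] := eqVneq j d.-1.
  by have := H2 (d - j)%N; rewrite subKn; [apply|]; lia.
by have := Hj i.+1; apply; have := ltn_ord i; lia.
Qed.

Lemma pochhammer_gt0 (a : R) k : 0 < a -> 0 < pochhammer a k.
Proof. by move=> a0; apply: prodr_gt0 => i _; rewrite ltr_wpDr. Qed.

(** The Wallis recursion applied k times, the j-th factor being (i + 1 + 2j) / (i + 2 + 2j); it
    accounts for the Pochhammer quotient in the normalization. *)
Lemma sin_int_wallis i k : sin_int (k + k + i) (1 : {poly R}) =
  pochhammer (i.+1%:R / 2) k / pochhammer (i.+2%:R / 2) k * sin_int i 1.
Proof.
elim: k => [|k IH]; first by rewrite !pochhammer0 divr1 mul1r.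
have p1 : pochhammer (i.+2%:R / 2) k != 0 :> R.
  by rewrite gt_eqF // pochhammer_gt0 // divr_gt0.
have := @sin_int1S R (k + k + i); rewrite IH => h.
rewrite (_ : (k.+1 + k.+1 + i = (k + k + i).+2)%N); last by lia.
have E1 : (k + k + i).+1%:R = 2 * (i.+1%:R / 2 + k%:R) :> R.
  by rewrite -addnS !natrD; field.
have E2 : (k + k + i).+2%:R = 2 * (i.+2%:R / 2 + k%:R) :> R.
  by rewrite -!addnS !natrD; field.
have p2 : i.+2%:R / 2 + k%:R != 0 :> R.
  by rewrite gt_eqF // ltr_wpDr // divr_gt0.
have p3 : 2 * (i.+2%:R / 2 + k%:R) != 0 :> R by rewrite mulf_neq0 // pnatr_eq0.
apply: (mulfI p3); rewrite -{1}E2 h E1 !pochhammerS.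
move: (i.+1%:R / 2) (i.+2%:R / 2) p1 p2 {E1 E2 p3 h} => a b p1 p2.
by field; rewrite p1 p2.
Qed.

(** The factor of [hfac_sqr] with j = d - k, attached to the angle theta_k. *)
Definition hfactor alpha k : R :=
  (idx alpha (d - k))`!%:R * pochhammer (k.+1%:R / 2) (sdeg alpha k) *
    ((idx alpha (d - k))%:R + lambda alpha (d - k)) /
  (pochhammer (2 * lambda alpha (d - k)) (idx alpha (d - k)) *
   pochhammer (k%:R / 2) (sdeg alpha k) * lambda alpha (d - k)).

Lemma hfac_sqrE alpha :
  hfac_sqr alpha = bfac alpha * \prod_(2 <= k < d) hfactor alpha k :> R.
Proof.
rewrite /hfac_sqr -(prod_rev_index hd); congr (_ * _).
rewrite !big_nat; apply: eq_bigr => j jd; rewrite /hfactor /sdeg.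
have -> : (d - (d - j) = j)%N by lia.
have -> : (d - j)%:R = d%:R - j%:R :> R by rewrite natrB //; lia.
by have -> : (d - j).+1%:R = d%:R - j%:R + 1 :> R; first by rewrite -natr1 natrB //; lia.
Qed.

Lemma lambda_pos alpha k : (2 <= k < d)%N -> 0 < lambda alpha (d - k) :> R.
Proof. by move=> /andP[k2 kd]; exact: (@lambda_gt0 R d alpha (Ordinal kd)). Qed.

Lemma hfactor_ge0 alpha k : (2 <= k < d)%N -> 0 <= hfactor alpha k.
Proof.
move=> kd; have l0 := lambda_pos alpha kd; have l2 : 0 < 2 * lambda alpha (d - k) :> R.
  by rewrite mulr_gt0.
have k0 : 0 < k%:R / 2 :> R by rewrite divr_gt0 // ltr0n; lia.
have k1 : 0 < k.+1%:R / 2 :> R by rewrite divr_gt0.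
have p1 := pochhammer_gt0 (sdeg alpha k) k1.
have p2 := pochhammer_gt0 (sdeg alpha k) k0.
have p3 := pochhammer_gt0 (idx alpha (d - k)) l2.
apply: divr_ge0; last by rewrite ltW // !mulr_gt0.
apply: mulr_ge0; last by apply: addr_ge0 => //; exact: ltW.
by apply: mulr_ge0 => //; exact: ltW.
Qed.

Lemma bfac_gt0 alpha : 0 < bfac alpha :> R.
Proof. by rewrite /bfac; case: ifP. Qed.

(** The Gegenbauer norm and the Wallis quotient cancel against [hfactor], leaving the factor of the
    sphere area for the same angle. *)
Lemma hfactor_angular alpha k : (2 <= k < d)%N ->
  hfactor alpha k * angular_int alpha alpha k.-1 = sin_int k.-1 1.
Proof.
case: k => [|k] // kd; rewrite angular_intE /=; last by lia.
rewrite /gegen -expr2.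
have l0 := lambda_pos alpha kd.
have lE := @two_lambda alpha k ltac:(lia).
have n0 : (0 < sdeg alpha k.+1 + sdeg alpha k.+1 + k)%N.
  by rewrite addn_gt0; apply/orP; right; lia.
have N := @gegenbauer_norm R _ (idx alpha (d - k.+1)) _ n0 lE.
move: N; rewrite sin_int_wallis /hfactor.
set J := sin_int _ _; set m := idx alpha _; set lam := lambda alpha _ in l0 *.
set t := sdeg alpha _; set W := sin_int k 1.
have p1 : pochhammer (k.+1%:R / 2) t != 0 :> R by rewrite gt_eqF // pochhammer_gt0 // divr_gt0.
have p2 : pochhammer (k.+2%:R / 2) t != 0 :> R by rewrite gt_eqF // pochhammer_gt0 // divr_gt0.
have p3 : pochhammer (2 * lam) m != 0 :> R by rewrite gt_eqF // pochhammer_gt0 // mulr_gt0.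
have l1 : lam != 0 by rewrite gt_eqF.
move: (pochhammer (k.+1%:R / 2) t) (pochhammer (k.+2%:R / 2) t) (pochhammer (2 * lam) m)
  p1 p2 p3 => a b c p1 p2 p3 N.
transitivity (J * (m`!%:R * (m%:R + lam)) * b / (c * a * lam)).
  by field; rewrite p1 p3 l1.
by rewrite N; field; rewrite p1 p2 p3 l1.
Qed.

Lemma sphere_dot_orthonormal alpha beta : (idx alpha d <= 1)%N ->
  (idx beta d <= 1)%N ->
  sphere_dot (@Y R d alpha) (@Y R d beta) = (alpha == beta)%:R.
Proof.
move=> ad bd; rewrite /sphere_dot sphere_integral_Y //.
have [<-|ne] := eqVneq alpha beta; last first.
  by rewrite prod_angular_eq0 // !mulr0.
have h0 : 0 <= hfac_sqr alpha :> R.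
  rewrite hfac_sqrE mulr_ge0 ?(ltW (bfac_gt0 _)) // big_nat prodr_ge0 // => k kd.
  exact: hfactor_ge0.
rewrite /hfac -expr2 sqr_sqrtr // hfac_sqrE.
(* Normalized, the integral of the square is the area, angle by angle: theta_1 contributes 2 pi and
   theta_(i+1) the integral of sin^i. *)
rewrite (_ : bfac alpha * _ * _ = sphere_area d) ?mulVf ?gt_eqF ?sphere_area_gt0 //.
rewrite sphere_areaE prod_split0 angular_int0 // !eqxx /=.
transitivity ((2 * pi) * ((\prod_(2 <= k < d) hfactor alpha k) *
  \prod_(1 <= i < d.-1) angular_int alpha alpha i)).
  have b0 : bfac alpha != 0 :> R by rewrite gt_eqF ?bfac_gt0.
  by field.
congr (_ * _); rewrite big_add1 -big_split /= !big_nat.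
by apply: eq_bigr => i id; apply: hfactor_angular; lia.
Qed.

End SphereIntegrals.

(** * The basis property *)

Section HarmonicBasis.
Context {R : realType} {d : nat} (hd : (2 < d)%N).
Implicit Types (alpha beta : d.-tuple nat) (n N : nat) (x : 'rV[R]_d).

Lemma Y_index_idx n alpha : Y_index n alpha -> (idx alpha d <= 1)%N.
Proof. by move=> [_ [] ->]. Qed.

Lemma deg_mdeg alpha : mdeg (Multinom alpha) = deg alpha.
Proof.
rewrite mdegE /deg big_add1 /= big_mkord; apply: eq_bigr => i _.
by rewrite /idx /= multinomE (tnth_nth 0%N).
Qed.

Lemma finite_Y_index n : finite_set (@Y_index d n).
Proof.
(* Entries of a tuple of degree n are at most n. *)
pose g (t : d.-tuple 'I_n.+1) : d.-tuple nat := map_tuple val t.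
apply: (@sub_finite_set _ _ (g @` [set: d.-tuple 'I_n.+1])); last first.
  exact/finite_image/finite_finset.
move=> alpha [da _]; exists (map_tuple inord alpha) => //.
apply: eq_from_tnth => i; rewrite !tnth_map /= inordK // ltnS -da -deg_mdeg mdegE.
by rewrite (bigD1 i) //= multinomE leq_addr.
Qed.

Lemma solid_harm_harmonic alpha n : Y_index n alpha ->
  [/\ (solid_harm hd alpha : mpoly d R) \is ishomog1 n mdeg,
      laplacian (solid_harm hd alpha : mpoly d R) = 0 &
      forall x, Y alpha x = meval (fun i : 'I_d => x 0 i) (solid_harm hd alpha)].
Proof.
move=> ha; have ad := Y_index_idx ha.
have dd : (2 <= d <= d)%N by rewrite leqnn ltnW.
split; last by move=> x; exact: Y_meval.
  by apply: dhomogZ; case: ha => <- _; rewrite -sdeg_full; exact: solid_homog.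
rewrite /solid_harm linearZ /=.
by have [_ -> _] := @solid_harmonic R d hd alpha d ad dd; rewrite scaler0.
Qed.

(** The uniqueness lemma for the last variable: monomials of another degree have coefficient 0 by
    homogeneity, and the rest with last exponent at most 1 are the index set. *)
Lemma harmonic_coef_eq0 n (p : mpoly d R) : p \is ishomog1 n mdeg ->
  laplacian p = 0 -> (forall alpha, Y_index n alpha -> mcoeff (Multinom alpha) p = 0) ->
  p = 0.
Proof.
move=> hp lp h0; have dm : (d.-1 < d)%N by lia.
apply: (@harmonic_eq0 R d p (Ordinal dm)) => // m m1.
have [dn|dn] := eqVneq (mdeg m) n; last exact: (dhomog_nemf_coeff hp dn).
case: m m1 dn => alpha m1 dn; apply: h0; split; first by rewrite -deg_mdeg.
move: m1; rewrite multinomE (tnth_nth 0%N) /idx /=.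
by case: (nth _ _ _) => [|[|//]] _; [left | right].
Qed.

Lemma Y_free N (t : 'I_N -> d.-tuple nat) (v : 'I_N -> R) : injective t ->
  (forall k, (idx (t k) d <= 1)%N) -> (forall x, \sum_k v k * Y (t k) x = 0) ->
  forall k, v k = 0.
Proof.
move=> tI td hv k.
have E := sphere_integral_sum hd (index_enum 'I_N) v td (td k).
(* The empty combination gives the integral of the zero function; the relation says that the
   combination is that function. *)
have E0 := @sphere_integral_sum R d hd 'I_N [::] t v (t k) td (td k).
rewrite big_nil in E0.
have {}E : \sum_k0 v k0 * (hfac (t k0) * hfac (t k) *
    \prod_(i < d.-1) angular_int (t k0) (t k) i) = 0 :> R.
  rewrite -E -[RHS]E0; congr sphere_integral; apply/funext => x.
  by rewrite big_nil hv.
move: E; rewrite (bigD1 k) //= [X in _ + X]big1 ?addr0 => [|j jk]; last first.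
  by rewrite prod_angular_eq0 ?mulr0 //; apply: contra_neq jk => /tI.
rewrite -sphere_integral_Y // => /eqP; rewrite mulf_eq0 => /orP[/eqP //|/eqP e].
have := sphere_dot_orthonormal hd (td k) (td k) (R := R).
by rewrite /sphere_dot e mulr0 eqxx => /eqP; rewrite eq_sym oner_eq0.
Qed.

Lemma Y_basis n : is_basis (@Y_index d n) (@Y R d) (harmonic_space R d n).
Proof.
have finA := finite_Y_index n.
pose s : seq (d.-tuple nat) := finmap.enum_fset (fset_set (@Y_index d n)).
pose t (k : 'I_(size s)) := tnth (in_tuple s) k.
have sA alpha : (alpha \in s) = (alpha \in @Y_index d n) by rewrite -(in_fset_set finA).
have tA k : Y_index n (t k) by apply/set_mem; rewrite -sA; exact: mem_tnth.
have td k : (idx (t k) d <= 1)%N := Y_index_idx (tA k).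
have sU : uniq s by exact: finmap.fset_uniq.
have tI : injective t.
  move=> j k; rewrite /t !(tnth_nth [tuple of nseq d 0%N]) /= => /eqP.
  by rewrite nth_uniq // => /eqP /val_inj.
have cov alpha : Y_index n alpha -> exists l, alpha = t l.
  by move=> ha; apply/(tnthP (in_tuple s)); rewrite sA; exact: mem_set.
have sumE (F : d.-tuple nat -> 'rV[R]_d -> R) :
    \sum_(alpha \in @Y_index d n) F alpha = \sum_k F (t k).
  by rewrite fsbig_finite //= -/s big_tnth.
split => //.
- move=> alpha ha; have [h1 h2 h3] := solid_harm_harmonic ha.
  by exists (solid_harm hd alpha).
- move=> c; rewrite sumE => h0 alpha ha.
  have [k ->] := cov alpha ha.
  apply: (Y_free (v := fun k => c (t k)) tI td) => x.
  by move/(congr1 (fun f => f x)): h0; rewrite fct_sumE.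
- move=> f [p [hp lp fp]].
  (* Coefficients of the solid harmonics at the index monomials: both are indexed by [s], so the
     matrix is square. *)
  pose M : 'M[R]_(size s) := \matrix_(k, l) mcoeff (Multinom (t l)) (solid_harm hd (t k)).
  pose S (v : 'rV[R]_(size s)) : mpoly d R := \sum_k v 0 k *: solid_harm hd (t k).
  have SH v : S v \is ishomog1 n mdeg.
    by apply: rpred_sum => k _; apply: dhomogZ; have [] := solid_harm_harmonic (tA k).
  have SL v : laplacian (S v) = 0.
    rewrite linear_sum big1 // => k _.
    by rewrite linearZ /=; have [_ -> _] := solid_harm_harmonic (tA k); rewrite scaler0.
  have SM v l : mcoeff (Multinom (t l)) (S v) = (v *m M) 0 l.
    by rewrite raddf_sum mxE; apply: eq_bigr => k _; rewrite /= mcoeffZ mxE.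
  have SY v x : meval (fun i : 'I_d => x 0 i) (S v) = \sum_k v 0 k * Y (t k) x.
    rewrite raddf_sum; apply: eq_bigr => k _ /=.
    by rewrite mevalZ; have [_ _ <-] := solid_harm_harmonic (tA k).
  (* For v in the left kernel, [S v] has no coefficient at an index monomial, so it is 0 by
     uniqueness, and v = 0 by independence. *)
  have Mu : M \in unitmx.
    rewrite -row_free_unit; apply: inj_row_free => v vM.
    have S0 : S v = 0.
      apply: (harmonic_coef_eq0 (SH v) (SL v)) => alpha /cov[l ->].
      by rewrite SM vM mxE.
    apply/rowP => k; rewrite mxE; apply: (Y_free (v := fun k => v 0 k) tI td) => x.
    by rewrite -SY S0 meval0.
  pose w : 'rV[R]_(size s) := \row_l mcoeff (Multinom (t l)) p.
  (* The combination with the same coefficients as p at the index monomials; uniqueness applied to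
     the difference gives p = [S v]. *)
  pose v := w *m invmx M.
  have pS : p = S v.
    apply/eqP; rewrite -subr_eq0; apply/eqP; apply: (@harmonic_coef_eq0 n).
    + by apply: rpredB; [exact: hp | exact: SH].
    + by rewrite linearB /= lp SL subrr.
    + move=> alpha /cov[l ->].
      by rewrite mcoeffB SM mulmxKV // mxE subrr.
  (* Transports v from positions in the enumeration to tuples: as [t] is injective, the value at
     [t k] is [v 0 k]. *)
  exists (fun alpha => \sum_k (t k == alpha)%:R * v 0 k).
  rewrite sumE; apply/funext => x; rewrite fp pS SY fct_sumE; apply: eq_bigr => k _.
  rewrite (bigD1 k) //= eqxx mul1r big1 ?addr0 // => j jk.
  by rewrite (negPf (contra_neq (@tI _ _) jk)) mul0r.
Qed.

End HarmonicBasis.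

Theorem theorem5p1 (R : realType) (d n : nat) (hd : (2 < d)%N) :
  [/\ (* Y_alpha does not depend on the choice of polar coordinates *)
      forall (alpha : d.-tuple nat) (x : 'rV[R]_d) (p : R * 'rV[R]_d.-1),
        Y_index n alpha -> polar_coordinates x p ->
        Y alpha x = Y_polar alpha p.1 p.2,
      is_basis (Y_index n) (@Y R d)
        (harmonic_space R d n)
    & forall alpha beta : d.-tuple nat, Y_index n alpha -> Y_index n beta ->
        sphere_dot (@Y R d alpha) (@Y R d beta) = (alpha == beta)%:R].
Proof.
split.
- move=> alpha x p /Y_index_idx ad xp.
  by rewrite (Y_meval hd) // (Y_polar_coordinates hd ad xp).
- exact: Y_basis.
- move=> alpha beta /Y_index_idx ad /Y_index_idx bd.
  exact: sphere_dot_orthonormal.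
Qed.
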